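(* Let $(r,\Lambda,A)$ be an admissible triple with $\Lambda$ cyclic and $\Lambda\neq\{1\}$. Then the group $\mathrm{F}(r,\Lambda,A)$ (in the pure group signature) interprets the Arithmetic $(\mathbb N,+,\times)$ without parameters.
   Context: An admissible triple $(r,\Lambda,A)$ consists of a real $r>0$, a subgroup $\Lambda$ of the multiplicative group $\mathbb R^*_+$, and an additive subgroup $A\subseteq\mathbb R$ with $r\in A$ and $\lambda A\subseteq A$ for all $\lambda\in\Lambda$. $\mathrm{F}(r,\Lambda,A)$ is the group of all homeomorphisms $x\colon[0,r)\to[0,r)$ (usual topology) that are piecewise affine with finitely many breakpoints, all slopes in $\Lambda$, and all breakpoints and their images in $A$; maps act on the right. An interpretation of $M$ in $N$ without parameters is a pair $(n,f)$ with $f$ a surjection from a subset of $N^n$ onto $M$ such that the preimage of every set $0$-definable in $M$ (under the map induced by $f$ on tuples) is definable in $N$ by a first-order formula without parameters. *)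

(* Defs.v *)
From Stdlib Require Import Reals Lra Lia ZArith Arith ClassicalEpsilon.
Open Scope R_scope.

Definition mult_pos_subgroup (Lam : R -> Prop) : Prop :=
  (forall l, Lam l -> 0 < l) /\ Lam 1 /\
  (forall l m, Lam l -> Lam m -> Lam (l * m)) /\
  (forall l, Lam l -> Lam (/ l)).

Definition add_subgroup (A : R -> Prop) : Prop :=
  A 0 /\ (forall a b, A a -> A b -> A (a + b)) /\ (forall a, A a -> A (- a)).

Definition admissible (r : R) (Lam A : R -> Prop) : Prop :=
  0 < r /\ mult_pos_subgroup Lam /\ add_subgroup A /\ A r /\
  (forall l a, Lam l -> A a -> A (l * a)).

Definition cyclic_subgroup (Lam : R -> Prop) : Prop :=
  exists g, forall l, Lam l <-> exists z : Z, l = powerRZ g z.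

(* Elements are homeomorphisms of [0,r); we represent them as maps      *)
(* R -> R which are the identity outside [0,r) (a normalization making  *)
(* Leibniz equality of functions coincide with equality on [0,r)).      *)

Definition Iv (r : R) (t : R) : Prop := 0 <= t < r.

Definition cont_on (D : R -> Prop) (f : R -> R) : Prop :=
  forall x, D x -> forall eps, 0 < eps -> exists delta, 0 < delta /\
    forall y, D y -> Rabs (y - x) < delta -> Rabs (f y - f x) < eps.

Definition homeo_on (D : R -> Prop) (f : R -> R) : Prop :=
  (forall t, D t -> D (f t)) /\
  exists g : R -> R,
    (forall t, D t -> D (g t)) /\
    (forall t, D t -> g (f t) = t) /\
    (forall t, D t -> f (g t) = t) /\
    cont_on D f /\ cont_on D g.

(* piecewise affine with finitely many breakpoints, slopes in Lam,
   breakpoints and their images in A.  The subdivision 0 = a_0 < ... < a_n = r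
   contains all breakpoints (extra points, including 0 and r, are harmless
   since 0, r are in A and f 0 = 0). *)
Definition pl_LA (r : R) (Lam A : R -> Prop) (f : R -> R) : Prop :=
  exists (n : nat) (a lam b : nat -> R),
    a 0%nat = 0 /\ a n = r /\
    (forall i, (i < n)%nat -> a i < a (S i)) /\
    (forall i, (i <= n)%nat -> A (a i)) /\
    (forall i, (i < n)%nat -> A (f (a i))) /\
    (forall i, (i < n)%nat -> Lam (lam i)) /\
    (forall i t, (i < n)%nat -> a i <= t < a (S i) -> f t = lam i * t + b i).

Definition InF (r : R) (Lam A : R -> Prop) (f : R -> R) : Prop :=
  (forall t, ~ Iv r t -> f t = t) /\ homeo_on (Iv r) f /\ pl_LA r Lam A f.

(* group operations (maps act on the right: t(xy) = (tx)y) *)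
Definition Fmul (f g : R -> R) : R -> R := fun t => g (f t).
Definition Fone : R -> R := fun t => t.
Definition Finv (r : R) (f : R -> R) : R -> R :=
  fun t => epsilon (inhabits 0)
    (fun s => (Iv r t -> Iv r s /\ f s = t) /\ (~ Iv r t -> s = t)).

Inductive formula (T : Type) : Type :=
| fEq  : T -> T -> formula T
| fNot : formula T -> formula T
| fAnd : formula T -> formula T -> formula T
| fOr  : formula T -> formula T -> formula T
| fImp : formula T -> formula T -> formula T
| fAll : nat -> formula T -> formula T
| fEx  : nat -> formula T -> formula T.
Arguments fEq {T}. Arguments fNot {T}. Arguments fAnd {T}. Arguments fOr {T}.
Arguments fImp {T}. Arguments fAll {T}. Arguments fEx {T}.

Definition upd {M : Type} (e : nat -> M) (n : nat) (m : M) : nat -> M :=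
  fun i => if Nat.eqb i n then m else e i.

Fixpoint sat {M T : Type} (dom : M -> Prop) (ev : (nat -> M) -> T -> M)
  (e : nat -> M) (p : formula T) : Prop :=
  match p with
  | fEq s t => ev e s = ev e t
  | fNot q => ~ sat dom ev e q
  | fAnd q1 q2 => sat dom ev e q1 /\ sat dom ev e q2
  | fOr q1 q2 => sat dom ev e q1 \/ sat dom ev e q2
  | fImp q1 q2 => sat dom ev e q1 -> sat dom ev e q2
  | fAll n q => forall m, dom m -> sat dom ev (upd e n m) q
  | fEx n q => exists m, dom m /\ sat dom ev (upd e n m) q
  end.

Inductive gterm : Type :=
| gvar : nat -> gterm
| gone : gterm
| gmul : gterm -> gterm -> gterm
| ginv : gterm -> gterm.

Fixpoint geval (r : R) (e : nat -> (R -> R)) (t : gterm) : R -> R :=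
  match t with
  | gvar n => e n
  | gone => Fone
  | gmul s u => Fmul (geval r e s) (geval r e u)
  | ginv s => Finv r (geval r e s)
  end.

Inductive aterm : Type :=
| avar : nat -> aterm
| aadd : aterm -> aterm -> aterm
| amul : aterm -> aterm -> aterm.

Fixpoint aeval (e : nat -> nat) (t : aterm) : nat :=
  match t with
  | avar n => e n
  | aadd s u => (aeval e s + aeval e u)%nat
  | amul s u => (aeval e s * aeval e u)%nat
  end.

(* A k-ary relation is a predicate on environments (nat -> M) depending *)
(* only on the first k coordinates.                                     *)

Definition env_in {M : Type} (dom : M -> Prop) (e : nat -> M) : Prop :=
  forall i, dom (e i).

Definition agree {M : Type} (k : nat) (a b : nat -> M) : Prop :=
  forall i, (i < k)%nat -> a i = b i.

Definition local {M : Type} (dom : M -> Prop) (k : nat)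
  (X : (nat -> M) -> Prop) : Prop :=
  forall a b, env_in dom a -> env_in dom b -> agree k a b -> (X a <-> X b).

Definition definable0 {M T : Type} (dom : M -> Prop) (ev : (nat -> M) -> T -> M)
  (k : nat) (X : (nat -> M) -> Prop) : Prop :=
  local dom k X /\
  exists phi : formula T, forall e, env_in dom e -> (X e <-> sat dom ev e phi).

Definition block {M : Type} (n j : nat) (b : nat -> M) : nat -> M :=
  fun i => b (n * j + i)%nat.

Definition interprets_arith {M T : Type} (dom : M -> Prop)
  (ev : (nat -> M) -> T -> M) : Prop :=
  exists (n : nat) (D : (nat -> M) -> Prop) (f : (nat -> M) -> nat),
    local dom n D /\
    (forall a b, env_in dom a -> env_in dom b -> agree n a b -> D a ->
       f a = f b) /\
    (forall m : nat, exists a, env_in dom a /\ D a /\ f a = m) /\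
    (forall (k : nat) (X : (nat -> nat) -> Prop),
       definable0 (fun _ : nat => True) aeval k X ->
       definable0 dom ev (n * k)%nat
         (fun b => (forall j, (j < k)%nat -> D (block n j b)) /\
                   X (fun j => f (block n j b)))).

(* Main.v *)
(* Let g < 1 generate Lambda. The logarithms to base g of the slopes at 0 and at r are two
   homomorphisms to Z. Elements commuting with x have commuting germs at 0, so their
   commutators are trivial wherever x has no fixed point near 0; this makes a form of
   disjointness of supports first-order. From it one defines, for an element p moving
   points near exactly one end, the kernel of the homomorphism at that end: y lies in it iff
   some conjugate of p has support disjoint from that of y. Such p cannot tell 0 from r, and
   all that follows is symmetric under the reflection t |-> r - t.

   Divisibility of exponents is definable because the exponents of the centralizer of w form
   a subgroup of Z, and w with slopes g^k and g^-k on two adjacent intervals gives kZ. Lcm and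
   addition then define squares, hence multiplication up to sign. The sign is recovered by
   comparing the two ends: an element without fixed points in (0, r) has exponents of opposite
   signs, and it is characterised by its centralizer pushing every support that misses a
   neighbourhood of one end into any neighbourhood of the other. *)

Require Import Defs.
From Stdlib Require Import Reals Lra Lia ZArith Arith Classical ClassicalEpsilon FunctionalExtensionality.
Open Scope R_scope.

(** The exponent at an end is a homomorphism to an abelian group, so every commutator is the
    identity near that end; commuting with [x] propagates this over any interval adjoining the end
    on which [x] has no fixed point. This is why commutators appear, and why overlap of supports is
    only claimed to be detected near an end. Products come from two identities: lcm(x, x + 1) = |x
    (x + 1)| and 2xy = (x + y)^2 - x^2 - y^2. Subgroups of [Z] do not separate an exponent from its
    negative, and no parameter-free formula separates the ends, because conjugation by the
    reflection is an automorphism. A number is therefore coded by an absolute value, and its codes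
    are chosen so that this absolute value is the same at both ends. Adding absolute values requires
    summands of equal sign, hence the need to compare signs. *)

Section Interpretation.

Variables (r : R) (Lam A : R -> Prop).
Hypothesis adm : admissible r Lam A.

(** * Closure properties of the slopes and of the breakpoints *)

Ltac adm_tac :=
  destruct adm as (? & (? & ? & ? & ?) & (? & ? & ?) & ? & ?); auto.

Lemma r_pos : 0 < r.
Proof. adm_tac. Qed.

Lemma Lam_pos l : Lam l -> 0 < l.
Proof. adm_tac. Qed.

Lemma Lam_1 : Lam 1.
Proof. adm_tac. Qed.

Lemma Lam_mul l m : Lam l -> Lam m -> Lam (l * m).
Proof. adm_tac. Qed.

Lemma Lam_inv l : Lam l -> Lam (/ l).
Proof. adm_tac. Qed.

Lemma A_0 : A 0.
Proof. adm_tac. Qed.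

Lemma A_r : A r.
Proof. adm_tac. Qed.

Lemma A_add a b : A a -> A b -> A (a + b).
Proof. adm_tac. Qed.

Lemma A_opp a : A a -> A (- a).
Proof. adm_tac. Qed.

Lemma A_sub a b : A a -> A b -> A (a - b).
Proof. intros; apply A_add; auto using A_opp. Qed.

Lemma A_scal l a : Lam l -> A a -> A (l * a).
Proof. adm_tac. Qed.

(** * Piecewise affine maps on closed intervals *)

Definition affine_piece (f : R -> R) (c d : R) : Prop :=
  c < d /\ A c /\ A d /\ A (f c) /\
  exists l, Lam l /\ forall t, c <= t <= d -> f t = f c + l * (t - c).

(* Closed pieces are used instead of the half-open ones of [pl_LA]: this version is
   symmetric under the reflection [t |-> r - t]. *)
Inductive pl (f : R -> R) (c : R) : R -> Prop :=
| pl_nil : A c -> A (f c) -> pl f c c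
| pl_snoc d e : pl f c d -> affine_piece f d e -> pl f c e.

Lemma affine_piece_A f c d : affine_piece f c d -> A (f d).
Proof.
  intros (H1 & H2 & H3 & H4 & l & Hl & H).
  rewrite H by lra. apply A_add; auto. apply A_scal; auto using A_sub.
Qed.

Lemma pl_A f c d : pl f c d -> c <= d /\ A c /\ A d /\ A (f c) /\ A (f d).
Proof.
  induction 1 as [|d e H IH P]; [intuition lra|].
  assert (H' := affine_piece_A _ _ _ P). destruct P as (P1 & P2 & P3 & _).
  intuition lra.
Qed.

Lemma affine_piece_ext f h c d :
  (forall t, c <= t <= d -> f t = h t) -> affine_piece f c d -> affine_piece h c d.
Proof.
  intros E (H1 & H2 & H3 & H4 & l & Hl & H).
  assert (Ec : f c = h c) by (apply E; lra).
  rewrite Ec in *. do 4 (split; auto).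
  exists l; split; auto. intros t Ht. rewrite <- E by lra. auto.
Qed.

Lemma pl_ext f h c d :
  (forall t, c <= t <= d -> f t = h t) -> pl f c d -> pl h c d.
Proof.
  intros E H. revert E. induction H as [|d e H IH P]; intros E.
  - apply pl_nil; auto. rewrite <- E by lra; auto.
  - assert (Hd := pl_A _ _ _ H). assert (P0 := P). destruct P0 as [P0 _].
    apply pl_snoc with d.
    + apply IH. intros; apply E; lra.
    + apply affine_piece_ext with f; auto. intros; apply E; lra.
Qed.

Lemma pl_one f c d : affine_piece f c d -> pl f c d.
Proof.
  intros P. apply pl_snoc with c; auto.
  destruct P as (_ & P2 & _ & P4 & _). apply pl_nil; auto.
Qed.

Lemma pl_app f c d e : pl f c d -> pl f d e -> pl f c e.
Proof. intros H. induction 1; auto. eapply pl_snoc; eauto. Qed.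

Lemma pl_incr f c d : pl f c d ->
  forall s t, c <= s -> s < t -> t <= d -> f s < f t.
Proof.
  induction 1 as [|d e H IH (P1 & _ & _ & _ & l & Hl & P)]; intros s t Hs Hst Ht; [lra|].
  apply Lam_pos in Hl.
  destruct (Rle_dec t d) as [Htd|Htd]; [apply IH; lra|].
  destruct (Rle_dec d s) as [Hds|Hds].
  - rewrite (P t), (P s) by lra.
    assert (l * (s - d) < l * (t - d)) by (apply Rmult_lt_compat_l; lra). lra.
  - assert (f s < f d) by (apply IH; lra).
    rewrite (P t) by lra.
    assert (0 < l * (t - d)) by (apply Rmult_lt_0_compat; lra). lra.
Qed.

Lemma pl_incr_le f c d : pl f c d ->
  forall s t, c <= s -> s <= t -> t <= d -> f s <= f t.
Proof.
  intros H s t Hs [Hst|<-] Ht; [|lra]. left; eapply pl_incr; eauto.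
Qed.

Lemma pl_lipschitz f c d : pl f c d ->
  exists K, 0 < K /\ forall s t, c <= s -> s <= t -> t <= d -> f t - f s <= K * (t - s).
Proof.
  induction 1 as [|d e H (K & HK & IH) (P1 & _ & _ & _ & l & Hl & P)].
  - exists 1. split; [lra|]. intros s t ? ? ?. replace t with s by lra. lra.
  - apply Lam_pos in Hl. exists (K + l). split; [lra|]. intros s t Hs Hst Ht.
    destruct (Rle_dec t d) as [Htd|Htd].
    { specialize (IH s t Hs Hst Htd). nra. }
    destruct (Rle_dec d s) as [Hds|Hds].
    + rewrite (P t), (P s) by lra. nra.
    + assert (f d - f s <= K * (d - s)) by (apply IH; lra).
      rewrite (P t) by lra. nra.
Qed.

Lemma pl_inverse f c d : pl f c d ->
  exists h, pl h (f c) (f d) /\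
    (forall t, c <= t <= d -> h (f t) = t) /\
    (forall s, f c <= s <= f d -> c <= h s <= d /\ f (h s) = s).
Proof.
  induction 1 as [H1 H2|d e H (h & IH1 & IH2 & IH3) P].
  - exists (fun _ => c). split; [apply pl_nil; auto|].
    split; intros t Ht; [lra|]. split; lra.
  - assert (Hcd : c <= d) by apply (pl_A _ _ _ H).
    assert (HAe := affine_piece_A _ _ _ P).
    assert (Hinc := pl_incr _ _ _ H).
    destruct P as (P1 & P2 & P3 & P4 & l & Hl & P).
    assert (Hl0 := Lam_pos _ Hl).
    assert (Hfe : f e = f d + l * (e - d)) by (apply P; lra).
    assert (0 < l * (e - d)) by (apply Rmult_lt_0_compat; lra).
    assert (Hfcd : f c <= f d) by (apply (pl_incr_le _ _ _ H); lra).
    exists (fun s => if Rle_dec s (f d) then h s else d + / l * (s - f d)).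
    split; [|split].
    + apply pl_snoc with (f d).
      * revert IH1. apply pl_ext. intros t Ht. destruct (Rle_dec t (f d)); lra.
      * split; [lra|]. do 2 (split; auto). split.
        { destruct (Rle_dec (f d) (f d)); [|lra]. rewrite IH2 by lra; auto. }
        exists (/ l). split; [apply Lam_inv; auto|]. intros t Ht.
        destruct (Rle_dec (f d) (f d)); [|lra].
        rewrite (IH2 d) by lra. destruct (Rle_dec t (f d)); [|auto].
        replace t with (f d) by lra. rewrite IH2 by lra. lra.
    + intros t Ht. destruct (Rle_dec (f t) (f d)) as [Hd|Hd].
      * apply IH2. split; [lra|]. destruct (Rle_dec t d); auto.
        rewrite (P t) in Hd by lra.
        assert (0 < l * (t - d)) by (apply Rmult_lt_0_compat; lra). lra.
      * assert (d <= t).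
        { destruct (Rle_dec d t); auto. exfalso; apply Hd. left. apply Hinc; lra. }
        rewrite (P t) by lra. field. lra.
    + intros s Hs. destruct (Rle_dec s (f d)) as [Hd|Hd].
      * destruct (IH3 s); [lra|]. split; [lra|auto].
      * assert (d <= d + / l * (s - f d) <= e).
        { split.
          - assert (0 < / l * (s - f d)); [|lra].
            apply Rmult_lt_0_compat; [apply Rinv_0_lt_compat|]; lra.
          - replace e with (d + / l * (l * (e - d))) by (field; lra).
            apply Rplus_le_compat_l, Rmult_le_compat_l; [|lra].
            left; apply Rinv_0_lt_compat; lra. }
        split; [lra|]. rewrite P by lra. field. lra.
Qed.

Lemma pl_split f c d : pl f c d -> forall e, A e -> c <= e <= d -> pl f c e /\ pl f e d.
Proof.
  induction 1 as [H1 H2|d d' H IH P]; intros e HA He.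
  - replace e with c by lra. split; apply pl_nil; auto.
  - destruct (Rle_dec e d) as [Hd|Hd].
    + destruct (IH e HA) as [IH1 IH2]; [lra|]. split; auto. eapply pl_snoc; eauto.
    + assert (P0 := P). destruct P as (P1 & P2 & P3 & P4 & l & Hl & P).
      assert (HAe : A (f e)).
      { rewrite P by lra. apply A_add; auto. apply A_scal; auto using A_sub. }
      split.
      * apply pl_snoc with d; auto. split; [lra|]. do 3 (split; auto).
        exists l; split; auto. intros; apply P; lra.
      * destruct (Req_dec e d') as [->|Hne]; [apply pl_nil; auto|].
        apply pl_one. split; [lra|]. do 3 (split; auto).
        exists l; split; auto. intros t Ht. rewrite (P t), (P e) by lra. lra.
Qed.

(** Induction on the pieces of [h], each pulled back through the single affine piece of [f];
    [pl_comp] then cuts [h] at the images of the breakpoints of [f]. *)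
Lemma pl_comp_affine f h c d l :
  A c -> A (f c) -> Lam l -> (forall t, c <= t <= d -> f t = f c + l * (t - c)) ->
  forall y, pl h (f c) y -> y <= f c + l * (d - c) ->
  pl (fun t => h (f t)) c (c + / l * (y - f c)).
Proof.
  intros HA HB Hl P y H. assert (Hl0 := Lam_pos _ Hl).
  assert (Hl1 : 0 < / l) by (apply Rinv_0_lt_compat; lra).
  assert (Hf : forall y, f c <= y <= f c + l * (d - c) ->
    c <= c + / l * (y - f c) <= d /\ f (c + / l * (y - f c)) = y).
  { intros z Hz.
    assert (c <= c + / l * (z - f c) <= d).
    { split; [nra|]. replace d with (c + / l * (l * (d - c))) by (field; lra).
      apply Rplus_le_compat_l, Rmult_le_compat_l; lra. }
    split; auto. rewrite P by lra. field. lra. }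
  induction H as [H1 H2|y z H IH Q]; intros Hy.
  - replace (c + / l * (f c - f c)) with c by ring. apply pl_nil; auto.
  - assert (Hcy : f c <= y) by apply (pl_A _ _ _ H).
    destruct Q as (Q1 & Q2 & Q3 & Q4 & m & Hm & Q).
    apply pl_snoc with (c + / l * (y - f c)); [apply IH; lra|].
    destruct (Hf y) as [Hy1 Hy2]; [lra|]. destruct (Hf z) as [Hz1 Hz2]; [lra|].
    split. { apply Rplus_lt_compat_l, Rmult_lt_compat_l; lra. }
    do 2 (split; [apply A_add; auto; apply A_scal; auto using A_sub, Lam_inv|]).
    rewrite Hy2. split; auto.
    exists (m * l). split; [apply Lam_mul; auto|]. intros t Ht.
    rewrite P by lra.
    assert (y <= f c + l * (t - c) <= z).
    { split.
      - replace y with (f c + l * (c + / l * (y - f c) - c)) at 1 by (field; lra).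
        apply Rplus_le_compat_l, Rmult_le_compat_l; lra.
      - replace z with (f c + l * (c + / l * (z - f c) - c)) by (field; lra).
        apply Rplus_le_compat_l, Rmult_le_compat_l; lra. }
    rewrite Q by lra. field. lra.
Qed.

Lemma pl_comp f h c d : pl f c d -> pl h (f c) (f d) -> pl (fun t => h (f t)) c d.
Proof.
  induction 1 as [H1 H2|d e H IH P]; intros hG.
  - apply pl_nil; auto. apply (pl_A _ _ _ hG).
  - assert (Hcd := pl_A _ _ _ H). destruct P as (P1 & P2 & P3 & P4 & l & Hl & P).
    assert (Hl0 := Lam_pos _ Hl).
    assert (Hfe : f e = f d + l * (e - d)) by (apply P; lra).
    assert (0 < l * (e - d)) by (apply Rmult_lt_0_compat; lra).
    assert (f c <= f d) by (apply (pl_incr_le _ _ _ H); lra).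
    destruct (pl_split _ _ _ hG (f d)) as [Hh1 Hh2]; [auto|lra|].
    apply pl_app with d; [apply IH; auto|].
    replace e with (d + / l * (f e - f d)) by (rewrite Hfe; field; lra).
    apply pl_comp_affine with e; auto. rewrite Hfe. lra.
Qed.

Lemma pl_flip f c d : pl f c d -> pl (fun t => r - f (r - t)) (r - d) (r - c).
Proof.
  induction 1 as [H1 H2|d e H IH P].
  - apply pl_nil; [apply A_sub; auto using A_r|].
    replace (r - (r - c)) with c by ring. apply A_sub; auto using A_r.
  - apply pl_app with (r - d); auto. apply pl_one.
    assert (HA := affine_piece_A _ _ _ P).
    destruct P as (P1 & P2 & P3 & P4 & l & Hl & P).
    split; [lra|]. do 2 (split; [apply A_sub; auto using A_r|]).
    replace (r - (r - e)) with e by ring. split; [apply A_sub; auto using A_r|].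
    exists l; split; auto. intros t Ht. rewrite (P (r - t)), (P e) by lra. lra.
Qed.

(** Pieces are added on the right, so left germs are the ones that induction yields; the germ at 0
    is obtained from the reflected map. *)
Lemma pl_left_germ f c d : pl f c d -> forall e, c < e <= d ->
  exists delta l, 0 < delta /\ Lam l /\ c <= e - delta /\
    forall t, e - delta <= t <= e -> f t = f e - l * (e - t).
Proof.
  induction 1 as [H1 H2|d d' H IH (P1 & _ & _ & _ & l & Hl & P)]; intros e He; [lra|].
  destruct (Rle_dec e d) as [Hd|Hd]; [apply IH; lra|].
  exists (e - d), l. assert (c <= d) by apply (pl_A _ _ _ H).
  split; [lra|]. split; auto. split; [lra|]. intros t Ht.
  rewrite (P t), (P e) by lra. lra.
Qed.

(** * Elements of the group as piecewise affine maps of the closed interval *)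

Definition pl_elt (f : R -> R) : Prop :=
  (forall t, ~ Iv r t -> f t = t) /\ f 0 = 0 /\ pl f 0 r.

Lemma pl_LA_of_pl f d : pl f 0 d -> 0 < d ->
  exists (n : nat) (a lam b : nat -> R),
    a 0%nat = 0 /\ a n = d /\
    (forall i, (i < n)%nat -> a i < a (S i)) /\
    (forall i, (i <= n)%nat -> A (a i)) /\
    (forall i, (i < n)%nat -> A (f (a i))) /\
    (forall i, (i < n)%nat -> Lam (lam i)) /\
    (forall i t, (i < n)%nat -> a i <= t < a (S i) -> f t = lam i * t + b i).
Proof.
  intros H _. induction H as [H1 H2|d e H (n & a & lam & b & I1 & I2 & I3 & I4 & I5 & I6 & I7) P].
  - exists 0%nat, (fun _ => 0), (fun _ => 1), (fun _ => 0).
    repeat split; auto; intros; lia.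
  - destruct P as (P1 & P2 & P3 & P4 & l & Hl & P).
    exists (S n), (fun i => if le_dec i n then a i else e),
      (fun i => if lt_dec i n then lam i else l),
      (fun i => if lt_dec i n then b i else f d - l * d).
    split; [destruct (le_dec 0 n); auto; lia|].
    split; [destruct (le_dec (S n) n); auto; lia|].
    split; [|split; [|split; [|split]]].
    + intros i Hi. destruct (le_dec i n); [|lia]. destruct (le_dec (S i) n).
      * apply I3; lia.
      * replace i with n by lia. lra.
    + intros i Hi. destruct (le_dec i n); auto.
    + intros i Hi. destruct (le_dec i n); [|lia].
      destruct (Nat.eq_dec i n) as [->|]; [congruence|]. apply I5; lia.
    + intros i Hi. destruct (lt_dec i n); auto.
    + intros i t Hi Ht. destruct (le_dec i n); [|lia].
      destruct (lt_dec i n); destruct (le_dec (S i) n); try lia.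
      * apply I7; auto.
      * replace i with n in Ht by lia. rewrite P by lra. lra.
Qed.

Lemma pl_elt_r f : pl_elt f -> f r = r.
Proof. intros (H & _). apply H. unfold Iv. lra. Qed.

Lemma pl_cont f : pl_elt f -> cont_on (Iv r) f.
Proof.
  intros (_ & _ & H) x Hx eps Heps. destruct (pl_lipschitz _ _ _ H) as (K & HK & L).
  assert (HI := pl_incr_le _ _ _ H).
  exists (eps / K). split; [apply Rdiv_lt_0_compat; lra|]. intros y Hy Hd.
  unfold Iv in *.
  assert (HK' : K * Rabs (y - x) < eps).
  { replace eps with (K * (eps / K)) by (field; lra). apply Rmult_lt_compat_l; lra. }
  destruct (Rle_dec x y) as [Hxy|Hxy].
  - specialize (L x y). specialize (HI x y). rewrite Rabs_right in HK' by lra.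
    rewrite Rabs_right by lra. lra.
  - specialize (L y x). specialize (HI y x). rewrite Rabs_left in HK' by lra.
    rewrite Rabs_left1 by lra. nra.
Qed.

Lemma pl_elt_Iv f t : pl_elt f -> Iv r t -> Iv r (f t).
Proof.
  intros H Ht. assert (Hr := pl_elt_r _ H). destruct H as (_ & H0 & H). unfold Iv in *.
  split.
  - rewrite <- H0 at 1. apply (pl_incr_le _ _ _ H); lra.
  - rewrite <- Hr. apply (pl_incr _ _ _ H); lra.
Qed.

Lemma pl_elt_inverse f : pl_elt f ->
  exists h, pl_elt h /\ (forall t, h (f t) = t) /\ (forall t, f (h t) = t).
Proof.
  intros H. assert (Hr := pl_elt_r _ H). assert (HI := fun t => pl_elt_Iv f t H).
  assert (H' := H). destruct H' as (Ho & H0 & Hp).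
  destruct (pl_inverse _ _ _ Hp) as (h & H1 & H2 & H3). rewrite H0, Hr in *.
  set (k := fun t => if excluded_middle_informative (Iv r t) then h t else t).
  assert (Hk : forall t, Iv r t -> Iv r (k t) /\ k t = h t).
  { intros t Ht. unfold k. destruct (excluded_middle_informative (Iv r t)); [|tauto].
    split; auto. destruct (H3 t) as [? E]; [unfold Iv in *; lra|]. split; [lra|].
    destruct (Req_dec (h t) r) as [Er|]; [|lra]. rewrite Er, Hr in E. unfold Iv in *. lra. }
  assert (Hk' : forall t, ~ Iv r t -> k t = t).
  { intros t Ht. unfold k. destruct (excluded_middle_informative (Iv r t)); tauto. }
  exists k. split; [split; [|split]|split]; auto.
  - destruct (Hk 0) as [_ ->]; [unfold Iv; assert (X := r_pos); lra|].
    specialize (H2 0). rewrite H0 in H2. apply H2. assert (X := r_pos); lra.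
  - revert H1. apply pl_ext. intros t Ht. destruct (Req_dec t r) as [->|].
    + rewrite Hk' by (unfold Iv; lra). specialize (H2 r). rewrite Hr in H2.
      apply H2. assert (X := r_pos); lra.
    + symmetry. apply Hk. unfold Iv; lra.
  - intros t. destruct (excluded_middle_informative (Iv r t)) as [Ht|Ht].
    + destruct (Hk (f t)) as [_ ->]; auto. apply H2. unfold Iv in *; lra.
    + rewrite (Ho t Ht). auto.
  - intros t. destruct (excluded_middle_informative (Iv r t)) as [Ht|Ht].
    + destruct (Hk t) as [_ ->]; auto. apply H3. unfold Iv in *; lra.
    + rewrite (Hk' t Ht). auto.
Qed.

Lemma InF_of_pl_elt f : pl_elt f -> InF r Lam A f.
Proof.
  intros H. split; [apply H|split].
  - split; [intros; apply pl_elt_Iv; auto|].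
    destruct (pl_elt_inverse f H) as (h & hG & H1 & H2). exists h.
    split; [intros; apply pl_elt_Iv; auto|]. repeat split; auto using pl_cont.
  - apply pl_LA_of_pl; [apply H|apply r_pos].
Qed.

(** Continuity carries the formula of a half-open piece of [pl_LA] to its right endpoint, which
    turns it into a closed piece. *)
Lemma affine_limit f x y l b : x < y ->
  (forall t, x <= t < y -> f t = l * t + b) ->
  (forall eps, 0 < eps -> exists delta, 0 < delta /\
     forall t, x <= t < y -> Rabs (t - y) < delta -> Rabs (f t - f y) < eps) ->
  f y = l * y + b.
Proof.
  intros Hxy P C. destruct (Req_dec (f y) (l * y + b)) as [|Hne]; auto. exfalso.
  set (e := Rabs (f y - (l * y + b))).
  assert (He : 0 < e) by (apply Rabs_pos_lt; lra).
  destruct (C (e / 2)) as (d & Hd & HC); [lra|].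
  assert (HL : 0 < 2 * (Rabs l + 1)) by (assert (X := Rabs_pos l); lra).
  (* A step this small keeps [y - h] in the piece and within [d] of [y], and makes [l * h] at most
     [e / 2]; two errors then add up to less than [e]. *)
  set (h := Rmin ((y - x) / 2) (Rmin (d / 2) (e / (2 * (Rabs l + 1))))).
  assert (hG : 0 < h).
  { unfold h. repeat apply Rmin_glb_lt; try lra. apply Rdiv_lt_0_compat; lra. }
  assert (h <= (y - x) / 2) by apply Rmin_l.
  assert (h <= d / 2) by (unfold h; eapply Rle_trans; [apply Rmin_r|apply Rmin_l]).
  assert (h <= e / (2 * (Rabs l + 1)))
    by (unfold h; eapply Rle_trans; [apply Rmin_r|apply Rmin_r]).
  specialize (HC (y - h)). rewrite P in HC by lra.
  assert (Hlh : Rabs (l * h) <= e / 2).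
  { rewrite Rabs_mult, (Rabs_right h) by lra.
    apply Rle_trans with ((Rabs l + 1) * h); [nra|].
    replace (e / 2) with ((Rabs l + 1) * (e / (2 * (Rabs l + 1)))) by (field; lra).
    apply Rmult_le_compat_l; lra. }
  assert (Rabs (l * (y - h) + b - f y) < e / 2).
  { apply HC; [lra|]. replace (y - h - y) with (- h) by ring.
    rewrite Rabs_Ropp, Rabs_right; lra. }
  assert (e <= Rabs (l * (y - h) + b - f y) + Rabs (l * h)); [|lra].
  unfold e. rewrite <- Rabs_Ropp.
  replace (- (f y - (l * y + b))) with (l * (y - h) + b - f y + l * h) by ring.
  apply Rabs_triang.
Qed.

(** The delicate point is [r]: normalization sets [f r = r], whereas the last affine piece tends to
    a value [L] not yet known. The map [k] takes the value [L] at [r], hence is increasing on the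
    closed interval; since [f] maps [0, r) onto itself, [f 0 = 0] and [L = r] follow. *)
Lemma pl_elt_of_InF f : InF r Lam A f -> pl_elt f.
Proof.
  intros (Ho & (HI & h & hG & H1 & H2 & HC & _) & n & a & lam & b & a0 & an & ai & aA & faA & lamL & P).
  assert (Hr := r_pos).
  assert (am : forall i, (i <= n)%nat -> forall j, (i <= j <= n)%nat -> a i <= a j).
  { intros i Hi j Hj. destruct Hj as [Hij Hj]. induction Hij as [|j Hij IH]; [lra|].
    assert (a j < a (S j)) by (apply ai; lia). assert (a i <= a j) by (apply IH; lia). lra. }
  assert (Hn : (0 < n)%nat) by (destruct n; [rewrite a0 in an; lra|lia]).
  assert (Hn1 : S (n - 1) = n) by lia.
  set (L := lam (n - 1)%nat * r + b (n - 1)%nat).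
  set (k := fun t => if Req_EM_T t r then L else f t).
  assert (kf : forall t, t <> r -> k t = f t).
  { intros t Ht. unfold k. destruct (Req_EM_T t r); tauto. }
  assert (kr : k r = L) by (unfold k; destruct (Req_EM_T r r); tauto).
  assert (P' : forall i t, (i < n)%nat -> a i <= t <= a (S i) -> k t = lam i * t + b i).
  { intros i t Hi Ht.
    assert (a i < a (S i)) by (apply ai; auto).
    assert (0 <= a i) by (rewrite <- a0; apply am; lia).
    assert (a (S i) <= r) by (rewrite <- an; apply am; lia).
    destruct (Req_dec t r) as [->|Htr].
    { rewrite kr. unfold L. destruct (Nat.eq_dec i (n - 1)) as [->|]; auto.
      assert (a (S i) <= a (n - 1)%nat) by (apply am; lia).
      assert (a (n - 1)%nat < a (S (n - 1))) by (apply ai; lia).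
      rewrite Hn1, an in *. lra. }
    rewrite kf by auto. destruct (Req_dec t (a (S i))) as [->|]; [|apply P; auto; lra].
    apply affine_limit with (a i); auto. intros eps Heps.
    destruct (HC (a (S i))) with (eps := eps) as (d & Hd & HC'); auto; [unfold Iv; lra|].
    exists d; split; auto. intros t Ht' Hd'. apply HC'; auto. unfold Iv; lra. }
  assert (kA : forall i, (i < n)%nat -> A (k (a i))).
  { intros i Hi. rewrite kf; auto. assert (a i < a (S i)) by (apply ai; auto).
    assert (a (S i) <= r) by (rewrite <- an; apply am; lia). lra. }
  assert (Hk : forall i, (i <= n)%nat -> pl k 0 (a i)).
  { induction i as [|i IH]; intros Hi.
    - rewrite a0. apply pl_nil; [apply A_0|]. rewrite <- a0. apply kA; lia.
    - apply pl_snoc with (a i); [apply IH; lia|].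
      assert (a i < a (S i)) by (apply ai; auto).
      split; auto. do 2 (split; [apply aA; lia|]). split; [apply kA; lia|].
      exists (lam i). split; [apply lamL; lia|]. intros t Ht.
      rewrite !(P' i) by (lia || lra). ring. }
  specialize (Hk n (le_n n)). rewrite an in Hk.
  assert (kinc := pl_incr _ _ _ Hk).
  assert (f00 : f 0 = 0).
  { assert (Iv r 0) by (unfold Iv; lra). assert (Hh0 := hG 0 H).
    assert (E := H2 0 H). destruct (Req_dec (h 0) 0) as [E'|]; [congruence|].
    assert (k 0 < k (h 0)) by (unfold Iv in *; apply kinc; lra).
    rewrite !kf in * by (unfold Iv in *; lra).
    assert (X := HI 0 H). unfold Iv in X. lra. }
  assert (EL : L = r).
  { destruct (Rtotal_order L r) as [Hlt|[|Hgt]]; auto; exfalso.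
    - assert (k 0 < k r) by (apply kinc; lra). rewrite kr, kf, f00 in * by lra.
      assert (HLI : Iv r L) by (unfold Iv; lra).
      assert (E := H2 L HLI). assert (HhL := hG L HLI). unfold Iv in HhL.
      assert (k (h L) < k r) by (apply kinc; lra). rewrite kr, kf in * by lra. lra.
    - assert (Hl := Lam_pos _ (lamL (n - 1)%nat ltac:(lia))).
      assert (Ha : a (n - 1)%nat < r).
      { assert (X := ai (n - 1)%nat). rewrite Hn1, an in X. apply X; lia. }
      assert (0 <= a (n - 1)%nat) by (rewrite <- a0; apply am; lia).
      set (l := lam (n - 1)%nat) in *.
      (* At distance [d] from [r], within the last piece, the value [L - l * d] is still at least
         [r], outside the range of [f]. *)
      set (d := Rmin (r - a (n - 1)%nat) ((L - r) / l)).
      assert (Hd : 0 < d) by (apply Rmin_glb_lt; [lra|apply Rdiv_lt_0_compat; lra]).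
      assert (d <= r - a (n - 1)%nat) by apply Rmin_l.
      assert (Hd2 : d <= (L - r) / l) by apply Rmin_r.
      assert (l * d <= L - r).
      { replace (L - r) with (l * ((L - r) / l)) by (field; lra). apply Rmult_le_compat_l; lra. }
      assert (E : k (r - d) = l * (r - d) + b (n - 1)%nat).
      { apply P'; [lia|]. rewrite Hn1, an. lra. }
      rewrite kf in E by lra.
      assert (X : Iv r (f (r - d))) by (apply HI; unfold Iv; lra).
      unfold Iv in X. unfold L in *. lra. }
  split; auto. split; auto. revert Hk. apply pl_ext. intros t Ht.
  destruct (Req_dec t r) as [->|]; auto. rewrite kr, EL. symmetry. apply Ho. unfold Iv; lra.
Qed.

Lemma InF_pl f : InF r Lam A f <-> pl_elt f.
Proof. split; auto using InF_of_pl_elt, pl_elt_of_InF. Qed.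

(** * Group operations, reflection and commutation *)

Variable g : R.
Hypothesis g01 : 0 < g < 1.
Hypothesis Lam_g : forall l, Lam l <-> exists z : Z, l = powerRZ g z.

Notation G := (InF r Lam A).
Notation inv := (Finv r).

Let rpos : 0 < r := r_pos.

Lemma G_out x t : G x -> ~ Iv r t -> x t = t.
Proof. intros H. apply H. Qed.

Lemma G_Iv x t : G x -> Iv r t -> Iv r (x t).
Proof. intros (_ & (H & _) & _). apply H. Qed.

Lemma G_0 x : G x -> x 0 = 0.
Proof. intros H. apply (InF_pl) in H. apply H. Qed.

Lemma G_ge_r x t : G x -> r <= t -> x t = t.
Proof. intros H Ht. apply G_out; auto. unfold Iv; lra. Qed.

Lemma G_incr x s t : G x -> s < t -> x s < x t.
Proof.
  intros H Hst.
  assert (HP := proj1 (InF_pl x) H). destruct HP as (_ & _ & HP).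
  assert (HI := pl_incr _ _ _ HP).
  destruct (excluded_middle_informative (Iv r s)) as [Hs|Hs];
  destruct (excluded_middle_informative (Iv r t)) as [Ht|Ht].
  - unfold Iv in *. apply HI; lra.
  - rewrite (G_out x t) by auto. assert (X := G_Iv x s H Hs). unfold Iv in *; lra.
  - rewrite (G_out x s) by auto. assert (X := G_Iv x t H Ht). unfold Iv in *; lra.
  - rewrite !G_out; auto.
Qed.

Lemma G_incr_inv x s t : G x -> x s < x t -> s < t.
Proof.
  intros H Hst. destruct (Rtotal_order s t) as [|[->|Hts]]; auto; [lra|].
  assert (X := G_incr x t s H Hts). lra.
Qed.

Lemma G_inj x s t : G x -> x s = x t -> s = t.
Proof.
  intros H E. destruct (Rtotal_order s t) as [L|[|L]]; auto;
  assert (X := G_incr x _ _ H L); lra.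
Qed.

(** The condition under [epsilon] in [Finv] has exactly one solution, the value of the inverse
    map. *)
Lemma G_Finv x : G x ->
  G (inv x) /\ (forall t, inv x (x t) = t) /\ (forall t, x (inv x t) = t).
Proof.
  intros H. assert (HP := proj1 (InF_pl x) H).
  destruct (pl_elt_inverse x HP) as (h & hG & H1 & H2).
  apply (InF_pl) in hG.
  replace (inv x) with h; [auto|]. extensionality t.
  unfold Finv. match goal with |- _ = epsilon _ ?P => set (Q := P) end.
  assert (X : Q (epsilon (inhabits 0) Q)).
  { apply epsilon_spec. exists (h t). split; intros Ht.
    - split; auto. apply G_Iv; auto.
    - apply G_out; auto. }
  revert X. generalize (epsilon (inhabits 0) Q). intros u [X1 X2].
  destruct (excluded_middle_informative (Iv r t)) as [Ht|Ht].
  - destruct (X1 Ht) as [_ <-]. auto.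
  - rewrite (X2 Ht). apply G_out; auto.
Qed.

Lemma G_inv x : G x -> G (inv x).
Proof. intros; apply G_Finv; auto. Qed.

Lemma inv_l x t : G x -> inv x (x t) = t.
Proof. intros; apply G_Finv; auto. Qed.

Lemma inv_r x t : G x -> x (inv x t) = t.
Proof. intros; apply G_Finv; auto. Qed.

Lemma inv_eq x y : G x -> (forall t, y (x t) = t) -> inv x = y.
Proof.
  intros H E. extensionality t. rewrite <- (inv_r x t H) at 2. rewrite E. auto.
Qed.

Lemma G_one : G Fone.
Proof.
  apply (InF_pl). split; [reflexivity|]. split; [reflexivity|].
  apply (pl_one). split; [lra|]. split; [apply A_0|].
  split; [apply A_r|]. split; [apply A_0|].
  exists 1. split; [apply Lam_1|]. intros. unfold Fone. ring.
Qed.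

Lemma G_mul x y : G x -> G y -> G (Fmul x y).
Proof.
  intros Hx Hy. apply (InF_pl).
  assert (Hx' := proj1 (InF_pl x) Hx).
  assert (Hy' := proj1 (InF_pl y) Hy).
  unfold Fmul. split; [|split].
  - intros t Ht. rewrite (G_out x), (G_out y); auto.
  - rewrite !G_0; auto.
  - apply (pl_comp); [apply Hx'|].
    rewrite (G_0 x), (G_ge_r x) by (auto; lra). apply Hy'.
Qed.

(** Conjugation by the reflection, an automorphism of the group that exchanges the two ends; the
    reflection itself reverses orientation and is not an element. *)
Definition flip (x : R -> R) : R -> R := fun t => r - x (r - t).

Lemma flip_flip x : flip (flip x) = x.
Proof. extensionality t. unfold flip. replace (r - (r - t)) with t by ring. ring. Qed.

Lemma flip_mul x y : flip (Fmul x y) = Fmul (flip x) (flip y).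
Proof. extensionality t. unfold flip, Fmul. do 2 f_equal. ring. Qed.

Lemma G_flip x : G x -> G (flip x).
Proof.
  intros H. apply (InF_pl).
  assert (H' := proj1 (InF_pl x) H). unfold flip. split; [|split].
  - intros t Ht. destruct (Req_dec t r) as [->|].
    + replace (r - r) with 0 by ring. rewrite G_0; auto. ring.
    + rewrite (G_out x); auto; [ring|]. unfold Iv in *. intros ?. apply Ht. lra.
  - rewrite (G_ge_r x) by (auto; lra). ring.
  - destruct H' as (_ & _ & H'). apply (pl_flip) in H'.
    rewrite Rminus_0_r, Rminus_diag in H'. exact H'.
Qed.

Lemma flip_inv x : G x -> flip (inv x) = inv (flip x).
Proof.
  intros H. symmetry. apply inv_eq; [apply G_flip; auto|].
  intros t. unfold flip. replace (r - (r - x (r - t))) with (x (r - t)) by ring.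
  rewrite inv_l by auto. ring.
Qed.

Definition commute (x y : R -> R) : Prop := Fmul x y = Fmul y x.

Lemma commuteE x y : commute x y <-> forall t, y (x t) = x (y t).
Proof.
  unfold commute. split; intros H; [|extensionality t; apply H].
  intros t. change (Fmul x y t = Fmul y x t). rewrite H. reflexivity.
Qed.

Lemma commute_sym x y : commute x y -> commute y x.
Proof. intros H. symmetry. exact H. Qed.

Lemma commute_refl x : commute x x.
Proof. reflexivity. Qed.

Lemma commute_one x : commute Fone x.
Proof. apply commuteE. reflexivity. Qed.

Lemma commute_mul a b x : commute a x -> commute b x -> commute (Fmul a b) x.
Proof.
  rewrite !commuteE. unfold Fmul. intros Ha Hb t. rewrite Hb, Ha. auto.
Qed.

Lemma commute_inv a x : G a -> commute a x -> commute (inv a) x.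
Proof.
  intros Ha. rewrite !commuteE. intros H t. apply (G_inj a); auto.
  rewrite inv_r, <- H, inv_r; auto.
Qed.

Lemma commute_of_supports w k : G w -> G k -> (forall t, w t = t \/ k t = t) -> commute w k.
Proof.
  intros Hw Hk D. apply commuteE. intros t.
  destruct (Req_dec (w t) t) as [E|E].
  - rewrite E. destruct (Req_dec (k t) t) as [E'|E']; [congruence|].
    destruct (D (k t)) as [->|X]; auto. apply G_inj in X; auto. tauto.
  - assert (X : w (w t) <> w t) by (intros X; apply G_inj in X; auto).
    destruct (D t) as [ | -> ]; [tauto|]. destruct (D (w t)); tauto.
Qed.

Lemma commute_flip x y : commute x y -> commute (flip x) (flip y).
Proof. unfold commute. intros H. rewrite <- !flip_mul, H. auto. Qed.

Lemma inv_fix x t : G x -> x t = t -> inv x t = t.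
Proof. intros H E. rewrite <- E at 1. apply inv_l; auto. Qed.

Lemma inv_move x t : G x -> x t < t -> t < inv x t.
Proof. intros H E. apply (G_incr_inv x); auto. rewrite inv_r; auto. Qed.

Lemma inv_move' x t : G x -> t < x t -> inv x t < t.
Proof. intros H E. apply (G_incr_inv x); auto. rewrite inv_r; auto. Qed.

(** * Powers of the generator *)

Lemma pw_pos k : 0 < powerRZ g k.
Proof. apply powerRZ_lt; lra. Qed.

Lemma pw_add j k : powerRZ g (j + k) = powerRZ g j * powerRZ g k.
Proof. apply powerRZ_add; lra. Qed.

Lemma pw_lt_1 k : (0 < k)%Z -> powerRZ g k < 1.
Proof.
  intros Hk. rewrite <- (Z2Nat.id k), <- pow_powerRZ by lia.
  apply pow_lt_1_compat; [lra|]. lia.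
Qed.

Lemma pw_neg k : powerRZ g (- k) = / powerRZ g k.
Proof. apply powerRZ_neg'. Qed.

Lemma pw_gt_1 k : (k < 0)%Z -> 1 < powerRZ g k.
Proof.
  intros Hk. replace k with (- - k)%Z by lia. rewrite pw_neg.
  assert (X := pw_lt_1 (- k) ltac:(lia)). assert (Y := pw_pos (- k)).
  rewrite <- Rinv_1. apply Rinv_lt_contravar; lra.
Qed.

Lemma pw_lt j k : (j < k)%Z -> powerRZ g k < powerRZ g j.
Proof.
  intros H. replace k with (j + (k - j))%Z by lia. rewrite pw_add.
  assert (X := pw_lt_1 (k - j) ltac:(lia)). assert (Y := pw_pos j). nra.
Qed.

Lemma pw_inj j k : powerRZ g j = powerRZ g k -> j = k.
Proof.
  intros H. destruct (Z.lt_trichotomy j k) as [L|[|L]]; auto; apply pw_lt in L; lra.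
Qed.

Lemma Lam_pw k : Lam (powerRZ g k).
Proof. apply Lam_g. eauto. Qed.

Lemma pw_small e : 0 < e -> exists k, (0 < k)%Z /\ powerRZ g k < e.
Proof.
  intros He. destruct (pow_lt_1_zero g) with (y := e) as (N & HN); auto.
  { rewrite Rabs_right; lra. }
  exists (Z.of_nat (S N)). split; [lia|]. rewrite <- pow_powerRZ.
  specialize (HN (S N) ltac:(lia)). rewrite Rabs_right in HN; auto.
  left. apply Rlt_gt, pow_lt; lra.
Qed.

Lemma A_IZR a z : A a -> A (IZR z * a).
Proof.
  intros Ha. induction z using Z.peano_ind.
  - rewrite Rmult_0_l. apply A_0.
  - rewrite succ_IZR, Rmult_plus_distr_r, Rmult_1_l. apply (A_add); auto.
  - rewrite <- Z.sub_1_r, minus_IZR, Rmult_minus_distr_r, Rmult_1_l.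
    apply (A_sub); auto.
Qed.

(** [A] contains all integer multiples of [g^k * r], and [g^k] tends to 0. *)
Lemma A_dense l m : l < m -> exists a, A a /\ l < a < m.
Proof.
  intros H. destruct (pw_small ((m - l) / r)) as (k & _ & Hk).
  { apply Rdiv_lt_0_compat; lra. }
  set (e := powerRZ g k * r).
  assert (He : 0 < e) by (apply Rmult_lt_0_compat; auto using pw_pos).
  assert (He2 : e < m - l).
  { unfold e. replace (m - l) with ((m - l) / r * r) by (field; lra).
    apply Rmult_lt_compat_r; lra. }
  destruct (archimed (l / e)) as [U1 U2].
  exists (IZR (up (l / e)) * e). split.
  - apply A_IZR. apply (A_scal); [apply Lam_pw|apply A_r].
  - assert (El : l = l / e * e) by (field; lra). nra.
Qed.

(** * Germs at the two ends *)

Definition germ (x : R -> R) (k : Z) : Prop :=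
  exists delta, 0 < delta <= r /\ forall t, 0 <= t <= delta -> x t = powerRZ g k * t.

Lemma germ_exists x : G x -> exists k, germ x k.
Proof.
  intros H. assert (H' := proj1 (InF_pl _) (G_flip x H)).
  destruct H' as (_ & _ & H').
  destruct (pl_left_germ _ _ _ H' r) as (d & l & Hd & Hl & Hdr & E); [lra|].
  apply Lam_g in Hl as (k & ->). exists k, d. split; [lra|]. intros t Ht.
  specialize (E (r - t) ltac:(lra)). unfold flip in E.
  replace (r - (r - t)) with t in E by ring. replace (r - r) with 0 in E by ring.
  rewrite G_0 in E by auto. lra.
Qed.

Lemma germ_unique x j k : germ x j -> germ x k -> j = k.
Proof.
  intros (d & Hd & E) (d' & Hd' & E'). apply pw_inj.
  set (t := Rmin d d'). assert (t <= d) by apply Rmin_l. assert (t <= d') by apply Rmin_r.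
  assert (0 < t) by (apply Rmin_glb_lt; lra).
  apply Rmult_eq_reg_r with t; [|lra]. rewrite <- E, <- E'; lra.
Qed.

Lemma germ_mul x y j k : germ x j -> germ y k -> germ (Fmul x y) (j + k).
Proof.
  intros (d & Hd & E) (d' & Hd' & E').
  assert (X := pw_pos j).
  exists (Rmin d (d' / powerRZ g j)).
  assert (H1 : Rmin d (d' / powerRZ g j) <= d) by apply Rmin_l.
  assert (H2 := Rmin_r d (d' / powerRZ g j)).
  split. { split; [|lra]. apply Rmin_glb_lt; [lra|]. apply Rdiv_lt_0_compat; lra. }
  intros t Ht. unfold Fmul. rewrite E by lra.
  rewrite E', pw_add; [ring|].
  split; [apply Rmult_le_pos; lra|].
  replace d' with (powerRZ g j * (d' / powerRZ g j)) by (field; lra).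
  apply Rmult_le_compat_l; lra.
Qed.

Lemma germ_one : germ Fone 0.
Proof. exists r. split; [lra|]. intros. unfold Fone. simpl. ring. Qed.

Definition expo0 (x : R -> R) : Z := epsilon (inhabits 0%Z) (germ x).

Lemma expo0_germ x : G x -> germ x (expo0 x).
Proof. intros H. unfold expo0. apply epsilon_spec, germ_exists; auto. Qed.

Lemma expo0_eq x k : germ x k -> expo0 x = k.
Proof.
  intros H. apply germ_unique with x; auto. unfold expo0. apply epsilon_spec. eauto.
Qed.

(* The end [0] is [false], the end [r] is [true]. *)
Definition at_end (e : bool) (x : R -> R) : R -> R := if e then flip x else x.
Definition expo (e : bool) (x : R -> R) : Z := expo0 (at_end e x).

Lemma at_endK e x : at_end e (at_end e x) = x.
Proof. destruct e; simpl; auto using flip_flip. Qed.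

Lemma G_at_end e x : G x -> G (at_end e x).
Proof. destruct e; simpl; auto using G_flip. Qed.

Lemma at_end_mul e x y : at_end e (Fmul x y) = Fmul (at_end e x) (at_end e y).
Proof. destruct e; simpl; auto using flip_mul. Qed.

Lemma at_end_inv e x : G x -> at_end e (inv x) = inv (at_end e x).
Proof. destruct e; simpl; auto using flip_inv. Qed.

Lemma commute_at_end e x y : commute x y -> commute (at_end e x) (at_end e y).
Proof. destruct e; simpl; auto using commute_flip. Qed.

Lemma expo_at_end e e' x : expo e (at_end e' x) = expo (xorb e e') x.
Proof. unfold expo. destruct e, e'; simpl; rewrite ?flip_flip; auto. Qed.

Lemma expo_mul e x y : G x -> G y -> expo e (Fmul x y) = (expo e x + expo e y)%Z.
Proof.
  intros. unfold expo. rewrite at_end_mul. apply expo0_eq, germ_mul; apply expo0_germ, G_at_end;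
    auto.
Qed.

Lemma expo_one e : expo e Fone = 0%Z.
Proof.
  apply expo0_eq. replace (at_end e Fone) with Fone; [apply germ_one|].
  destruct e; auto. extensionality t. unfold at_end, flip, Fone. ring.
Qed.

Lemma expo_inv e x : G x -> expo e (inv x) = (- expo e x)%Z.
Proof.
  intros H. assert (E := expo_mul e x (inv x) H (G_inv x H)).
  replace (Fmul x (inv x)) with Fone in E.
  - rewrite expo_one in E. lia.
  - extensionality t. unfold Fmul, Fone. rewrite inv_l; auto.
Qed.

(** The witness is a power of [v], so one element scales the exponents at both ends by the same
    factor. *)
Lemma commute_power x v : G x -> G v -> commute v x -> forall z : Z,
  exists v', G v' /\ commute v' x /\ forall e, expo e v' = (z * expo e v)%Z.
Proof.
  intros Hx Hv C. induction z as [|z (v' & G' & C' & E')|z (v' & G' & C' & E')] using Z.peano_ind.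
  - exists Fone. split; [apply G_one|]. split; [apply commute_one|]. intros. rewrite expo_one.
    lia.
  - exists (Fmul v' v). split; [apply G_mul; auto|]. split; [apply commute_mul; auto|].
    intros e. rewrite expo_mul, E' by auto. lia.
  - exists (Fmul v' (inv v)). split; [apply G_mul; auto using G_inv|].
    split; [apply commute_mul; auto using commute_inv|].
    intros e. rewrite expo_mul, expo_inv, E' by auto using G_inv. lia.
Qed.

Lemma expo0_pos x : G x -> (0 < expo0 x)%Z ->
  exists d, 0 < d <= r /\ forall t, 0 < t <= d -> x t < t.
Proof.
  intros H Hk. destruct (expo0_germ x H) as (d & Hd & E). exists d. split; auto.
  intros t Ht. rewrite E by lra. apply pw_lt_1 in Hk. nra.
Qed.

Lemma expo0_neg x : G x -> (expo0 x < 0)%Z ->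
  exists d, 0 < d <= r /\ forall t, 0 < t <= d -> t < x t.
Proof.
  intros H Hk. destruct (expo0_germ x H) as (d & Hd & E). exists d. split; auto.
  intros t Ht. rewrite E by lra. apply pw_gt_1 in Hk. nra.
Qed.

Lemma expo0_zero x : G x -> expo0 x = 0%Z ->
  exists d, 0 < d < r /\ forall t, t <= d -> x t = t.
Proof.
  intros H Hk. destruct (expo0_germ x H) as (d & Hd & E). exists (d / 2). split; [lra|].
  intros t Ht. destruct (Rlt_dec t 0) as [L|L].
  - apply G_out; auto. unfold Iv; lra.
  - rewrite E by lra. rewrite Hk. simpl. ring.
Qed.

Lemma expo0_nonzero x : G x -> expo0 x <> 0%Z ->
  exists d, 0 < d <= r /\ forall t, 0 < t <= d -> x t <> t.
Proof.
  intros H Hk. destruct (Z.lt_total (expo0 x) 0) as [L|[|L]]; [|tauto|].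
  - destruct (expo0_neg x H L) as (d & Hd & E). exists d. split; auto.
    intros t Ht. specialize (E t Ht). lra.
  - destruct (expo0_pos x H L) as (d & Hd & E). exists d. split; auto.
    intros t Ht. specialize (E t Ht). lra.
Qed.

Lemma expo0_zero_of_fix x d : 0 < d -> (forall t, 0 < t < d -> x t = t) -> G x -> expo0 x = 0%Z.
Proof.
  intros Hd E H. destruct (Z.eq_dec (expo0 x) 0) as [|N]; auto. exfalso.
  destruct (expo0_nonzero x H N) as (d' & Hd' & E').
  assert (0 < Rmin d d') by (apply Rmin_glb_lt; lra).
  assert (Rmin d d' <= d) by apply Rmin_l. assert (Rmin d d' <= d') by apply Rmin_r.
  apply (E' (Rmin d d' / 2)); [lra|]. apply E; lra.
Qed.

Lemma expo0_pos_of_lt x d : 0 < d -> (forall t, 0 < t < d -> x t < t) -> G x -> (0 < expo0 x)%Z.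
Proof.
  intros Hd E H. destruct (Z.lt_total (expo0 x) 0) as [N|[N|]]; auto; exfalso.
  - destruct (expo0_neg x H N) as (d' & Hd' & E').
    assert (0 < Rmin d d') by (apply Rmin_glb_lt; lra).
    assert (Rmin d d' <= d) by apply Rmin_l. assert (Rmin d d' <= d') by apply Rmin_r.
    specialize (E (Rmin d d' / 2)). specialize (E' (Rmin d d' / 2)). lra.
  - destruct (expo0_zero x H N) as (d' & Hd' & E').
    assert (0 < Rmin d d') by (apply Rmin_glb_lt; lra).
    assert (Rmin d d' <= d) by apply Rmin_l. assert (Rmin d d' <= d') by apply Rmin_r.
    specialize (E (Rmin d d' / 2)). specialize (E' (Rmin d d' / 2)). lra.
Qed.

Lemma expo_true_zero x : G x -> expo true x = 0%Z ->
  exists d, 0 < d < r /\ forall t, d <= t -> x t = t.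
Proof.
  intros H E. destruct (expo0_zero _ (G_flip x H) E) as (d & Hd & F).
  exists (r - d). split; [lra|]. intros t Ht. specialize (F (r - t) ltac:(lra)).
  unfold flip in F. replace (r - (r - t)) with t in F by ring. lra.
Qed.

(** * Bumps *)

(** Slope [l] on an interval of length [a], then slope [/ l] on one of length [l * a]: the image
    lengths are [l * a] and [a], so the total length is kept. For [l] in [Lam], all breakpoints and
    their images lie in [A] as soon as [p] and [a] do. *)
Definition bump (p a l : R) : R -> R := fun t =>
  if Rle_dec t p then t
  else if Rle_dec t (p + a) then p + l * (t - p)
  else if Rle_dec t (p + a + l * a) then p + l * a + / l * (t - (p + a))
  else t.

Lemma bump_out p a l t : 0 < a -> 0 < l -> t <= p \/ p + a + l * a <= t -> bump p a l t = t.
Proof.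
  intros Ha Hl Ht. assert (0 < l * a) by (apply Rmult_lt_0_compat; auto).
  unfold bump. destruct (Rle_dec t p); auto.
  destruct (Rle_dec t (p + a)); [lra|]. destruct (Rle_dec t (p + a + l * a)); auto.
  replace t with (p + a + l * a) by lra. field. lra.
Qed.

Lemma bump_left p a l t : p <= t <= p + a -> bump p a l t = p + l * (t - p).
Proof.
  intros Ht. unfold bump. destruct (Rle_dec t p).
  - replace t with p by lra. ring.
  - destruct (Rle_dec t (p + a)); lra.
Qed.

Lemma bump_right p a l t : 0 < a -> p + a <= t <= p + a + l * a ->
  bump p a l t = p + l * a + / l * (t - (p + a)).
Proof.
  intros Ha Ht. destruct (Req_dec t (p + a)) as [->|].
  - rewrite bump_left by lra. ring.
  - unfold bump. destruct (Rle_dec t p); [lra|].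
    destruct (Rle_dec t (p + a)); [lra|]. destruct (Rle_dec t (p + a + l * a)); lra.
Qed.

Lemma bump_lt p a l t : 0 < a -> 0 < l < 1 -> p < t < p + a + l * a -> bump p a l t < t.
Proof.
  intros Ha Hl Ht. destruct (Rle_dec t (p + a)).
  - rewrite bump_left by lra. nra.
  - rewrite bump_right by lra.
    apply Rmult_lt_reg_l with l; [lra|].
    replace (l * (p + l * a + / l * (t - (p + a)))) with (l * p + l * l * a + (t - (p + a)))
      by (field; lra). nra.
Qed.

Lemma pl_piece f c d l : c <= d -> A c -> A d -> A (f c) -> Lam l ->
  (forall t, c <= t <= d -> f t = f c + l * (t - c)) -> pl f c d.
Proof.
  intros Hcd Hc Hd Hf Hl P. destruct (Req_dec c d) as [<-|].
  - apply pl_nil; auto.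
  - apply (pl_one). split; [lra|]. do 3 (split; auto). eauto.
Qed.

Lemma G_bump p a l : A p -> A a -> Lam l -> 0 <= p -> 0 < a -> p + a + l * a <= r ->
  G (bump p a l).
Proof.
  intros HAp HAa HLl Hp Ha Hr. assert (Hl := Lam_pos l HLl).
  assert (Hla : 0 < l * a) by (apply Rmult_lt_0_compat; auto).
  assert (A0 := A_0). assert (Ar := A_r).
  assert (L1 := Lam_1).
  assert (A1 : A (p + a)) by (apply (A_add); auto).
  assert (A2 : A (l * a)) by (apply (A_scal); auto).
  assert (A3 : A (p + a + l * a)) by (apply (A_add); auto).
  assert (A4 : A (p + l * a)) by (apply (A_add); auto).
  assert (E0 : bump p a l 0 = 0) by (apply bump_out; lra).
  assert (Ep : bump p a l p = p) by (apply bump_out; lra).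
  assert (Ea : bump p a l (p + a) = p + l * a) by (rewrite bump_left by lra; ring).
  assert (Ee : bump p a l (p + a + l * a) = p + a + l * a) by (apply bump_out; lra).
  apply (InF_pl). split; [|split; auto].
  - intros t Ht. apply bump_out; auto. unfold Iv in Ht.
    destruct (Rle_dec t p); [auto|]. right. destruct (Rle_dec r t); lra.
  - apply (pl_app _ _ (p + a + l * a)); [apply (pl_app _ _ (p + a)); [apply (pl_app _ _ p)|]|].
    + apply pl_piece with 1; rewrite ?E0; auto. intros t Ht. rewrite bump_out by lra. ring.
    + apply pl_piece with l; rewrite ?Ep; auto; [lra|]. intros t Ht. rewrite bump_left by lra.
      ring.
    + apply pl_piece with (/ l); rewrite ?Ea; auto; [lra| |].
      * apply (Lam_inv); auto.
      * intros t Ht. rewrite bump_right by lra. ring.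
    + apply pl_piece with 1; rewrite ?Ee; auto. intros t Ht. rewrite bump_out by lra. ring.
Qed.

Lemma bump_exists l t m : 0 <= l -> l < t < m -> m <= r ->
  exists w, G w /\ w t <> t /\ forall s, s <= l \/ m <= s -> w s = s.
Proof.
  intros Hl Ht Hm. destruct (A_dense l t) as (p & HAp & Hp); [lra|].
  (* The support of [bump p a g] ends at [p + (1 + g) * a]; this choice puts the end between [t] and
     [m]. *)
  destruct (A_dense ((t - p) / (1 + g)) ((m - p) / (1 + g))) as (a & HAa & Ha1 & Ha2).
  { apply Rmult_lt_compat_r; [apply Rinv_0_lt_compat|]; lra. }
  assert (H1 : t - p < a + g * a).
  { replace (t - p) with ((t - p) / (1 + g) * (1 + g)) by (field; lra). nra. }
  assert (H2 : a + g * a < m - p).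
  { replace (m - p) with ((m - p) / (1 + g) * (1 + g)) by (field; lra). nra. }
  assert (Ha : 0 < a) by nra.
  exists (bump p a g). split; [|split].
  - apply G_bump; auto; try lra. rewrite <- powerRZ_1. apply Lam_pw.
  - assert (X := bump_lt p a g t). lra.
  - intros s Hs. apply bump_out; lra.
Qed.

(** A bump that moves [t] and fixes [y t] cannot commute with [y]; its support is shrunk around [t]
    until it omits [y t]. *)
Lemma noncommuting_bump y l t m : G y -> y t <> t -> 0 <= l -> l < t < m -> m <= r ->
  exists w, G w /\ ~ commute w y /\ forall s, s <= l \/ m <= s -> w s = s.
Proof.
  intros Hy Hyt Hl Ht Hm.
  assert (X : exists l' m', l <= l' < t /\ t < m' <= m /\ (y t <= l' \/ m' <= y t)).
  { destruct (Rlt_dec t (y t)).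
    - exists l, (Rmin m (y t)). assert (Y := Rmin_r m (y t)). assert (Z := Rmin_l m (y t)).
      assert (t < Rmin m (y t)) by (apply Rmin_glb_lt; lra). lra.
    - exists (Rmax l (y t)), m. assert (Y := Rmax_r l (y t)). assert (Z := Rmax_l l (y t)).
      assert (Rmax l (y t) < t) by (apply Rmax_lub_lt; lra). lra. }
  destruct X as (l' & m' & H1 & H2 & H3).
  destruct (bump_exists l' t m') as (w & Hw & Hwt & Ho); try lra.
  exists w. split; auto. split; [|intros s Hs; apply Ho; lra].
  rewrite commuteE. intros C. specialize (C t). rewrite (Ho (y t)) in C by lra.
  apply G_inj in C; auto.
Qed.

Lemma noncommuting_pair l m : 0 <= l -> l < m -> m <= r ->
  exists a b, G a /\ G b /\ ~ commute b a /\
    forall s, s <= l \/ m <= s -> a s = s /\ b s = s.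
Proof.
  intros Hl Hlm Hm.
  destruct (bump_exists l ((l + m) / 2) m) as (a & Ha & Hat & Hao); try lra.
  destruct (noncommuting_bump a l ((l + m) / 2) m) as (b & Hb & Hab & Hbo); auto; try lra.
  exists a, b. do 3 (split; auto).
Qed.

Lemma shrinking s t : 0 < s -> t < r -> exists h, G h /\ h t < s.
Proof.
  intros Hs Ht. destruct (A_dense (Rmax 0 t) r) as (a & HAa & Ha1 & Ha2).
  { apply Rmax_lub_lt; lra. }
  assert (X := Rmax_l 0 t). assert (Y := Rmax_r 0 t).
  (* The slope [l] of a bump at 0: the first bound gives [l * a < s], the second leaves room for the
     return piece, [a + l * a < r]. *)
  destruct (pw_small (Rmin (s / r) ((r - a) / r))) as (k & Hk & E).
  { apply Rmin_glb_lt; apply Rdiv_lt_0_compat; lra. }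
  assert (E1 := Rmin_l (s / r) ((r - a) / r)). assert (E2 := Rmin_r (s / r) ((r - a) / r)).
  assert (P := pw_pos k). set (l := powerRZ g k) in *.
  assert (l * r < s).
  { replace s with (s / r * r) by (field; lra). apply Rmult_lt_compat_r; lra. }
  assert (l * r < r - a).
  { replace (r - a) with ((r - a) / r * r) by (field; lra). apply Rmult_lt_compat_r; lra. }
  assert (l * a < l * r) by (apply Rmult_lt_compat_l; lra).
  assert (HG : G (bump 0 a l)).
  { apply G_bump; auto; try lra; [apply A_0|apply Lam_pw]. }
  exists (bump 0 a l). split; auto.
  assert (Z := G_incr _ t a HG ltac:(lra)). rewrite (bump_left 0 a l a) in Z by lra. lra.
Qed.

#[local] Hint Resolve G_inv G_mul G_at_end G_flip G_one : core.

(** * Disjointness of supports and triviality at an end, in first-order terms *)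

Definition commutator (a b : R -> R) : R -> R := Fmul (Fmul (inv a) (inv b)) (Fmul a b).
Definition conjugate (p h : R -> R) : R -> R := Fmul (Fmul (inv h) p) h.

(** The commutators of the centralizer of [x] are plentiful where [x] is the identity, and trivial
    next to an end near which [x] has no fixed point. Through this relation [disjoint x y] places
    [y] in their double centralizer. *)
Definition commutes_with_commutators (x w : R -> R) : Prop :=
  forall a, G a -> forall b, G b -> commute a x -> commute b x -> commute w (commutator a b).
(* Implied by disjointness of the supports, and false when both elements move points near the
   same end; nothing more is needed. *)
Definition disjoint (x y : R -> R) : Prop := forall w, G w -> commutes_with_commutators x w ->
  commute w y.
Definition trivial_at (p y : R -> R) : Prop := exists h, G h /\ disjoint y (conjugate p h).
(** An element that is the identity near both ends can be conjugated off itself. So the first two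
    conditions make each of [p] and [q] move points near some end, and disjointness makes these ends
    different. *)
Definition end_pair (p q : R -> R) : Prop := ~ trivial_at p p /\ ~ trivial_at q q /\ disjoint p q.
(** For an end pair, [w] is a support to be pushed, away from the end of [q]; [y], the identity near
    the end of [p], is the region that the pushed support has to leave. *)
Definition full_support (p q u : R -> R) : Prop :=
  forall w, G w -> forall y, G y -> trivial_at q w -> trivial_at p y ->
  exists v, G v /\ commute v u /\ disjoint (conjugate w v) y.

Lemma G_commutator a b : G a -> G b -> G (commutator a b).
Proof. intros. unfold commutator. auto. Qed.

Lemma G_conjugate p h : G p -> G h -> G (conjugate p h).
Proof. intros. unfold conjugate. auto. Qed.

#[local] Hint Resolve G_commutator G_conjugate : core.

(** Let [s] be the supremum up to which [k] is the identity. If [z] commutes with [k] and [z s < s],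
    then [k] is the identity on the preimage under [z] of the points below [s], which reaches beyond
    [s]. While [s < c], [x] or its inverse is such a [z]. *)
Lemma fixed_spreads x k c d : G x -> G k -> commute k x ->
  (forall t, 0 < t < c -> x t <> t) ->
  0 < d -> (forall t, t < d -> k t = t) -> forall t, t < c -> k t = t.
Proof.
  intros Hx Hk C Hfree Hd Hkd.
  destruct (Rle_dec c d) as [Hcd|Hcd]; [intros; apply Hkd; lra|].
  set (E := fun s => s <= c /\ forall t, t < s -> k t = t).
  destruct (completeness E) as (s & Hub & Hlub).
  { exists c. intros s Hs. apply Hs. }
  { exists d. split; auto. lra. }
  assert (Hds : d <= s) by (apply Hub; split; auto; lra).
  assert (Hsc : s <= c) by (apply Hlub; intros s' Hs'; apply Hs').
  assert (Hks : forall t, t < s -> k t = t).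
  { intros t Ht. apply NNPP. intros N. apply Rlt_not_le in Ht. apply Ht, Hlub.
    intros s' [_ Hs']. destruct (Rle_dec s' t); auto. exfalso. apply N, Hs'. lra. }
  destruct Hsc as [Hsc| ->]; auto. exfalso.
  assert (X : forall z, G z -> commute k z -> z s < s -> False).
  { intros z Hz Cz Hzs. assert (Hm := inv_move _ _ Hz Hzs).
    assert (HE : E (Rmin c (inv z s))).
    { split; [apply Rmin_l|]. intros t Ht. assert (Y := Rmin_r c (inv z s)).
      apply (G_inj z); auto. apply (proj1 (commuteE _ _)) with (t := t) in Cz. rewrite Cz.
      apply Hks. rewrite <- (inv_r z s Hz). apply G_incr; auto. lra. }
    apply Hub in HE. revert HE. apply Rlt_not_le, Rmin_glb_lt; auto. }
  destruct (Rtotal_order (x s) s) as [L|[L|L]].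
  - apply (X x); auto.
  - apply (Hfree s); lra.
  - apply (X (inv x)); auto using inv_move'. apply commute_sym, commute_inv; auto.
    apply commute_sym; auto.
Qed.

Lemma commute_commutator a b x : G a -> G b -> commute a x -> commute b x ->
  commute (commutator a b) x.
Proof. intros. unfold commutator. auto 6 using commute_mul, commute_inv. Qed.

Lemma expo_commutator e a b : G a -> G b -> expo e (commutator a b) = 0%Z.
Proof. intros. unfold commutator. rewrite !expo_mul, !expo_inv by auto. lia. Qed.

Lemma expo_conjugate e p h : G p -> G h -> expo e (conjugate p h) = expo e p.
Proof. intros. unfold conjugate. rewrite !expo_mul, !expo_inv by auto. lia. Qed.

Lemma commutator_trivial x a b c : G x -> G a -> G b -> commute a x -> commute b x ->
  (forall t, 0 < t < c -> x t <> t) -> forall t, t < c -> commutator a b t = t.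
Proof.
  intros Hx Ha Hb Ca Cb Hfree.
  destruct (expo0_zero (commutator a b)) as (d & Hd & E); auto using G_commutator.
  { apply (expo_commutator false); auto. }
  apply fixed_spreads with x d; auto using G_commutator, commute_commutator; [lra|].
  intros t Ht. apply E. lra.
Qed.

(* Elements commuting with [x] have pairwise commuting germs at [0], so their commutators
   are trivial as long as [x] has no fixed points. *)
Lemma commutes_with_commutators_free x w c : G x -> G w -> (forall t, 0 < t < c -> x t <> t) ->
  (forall t, c <= t -> w t = t) -> commutes_with_commutators x w.
Proof.
  intros Hx Hw Hfree Hwo a Ha b Hb Ca Cb.
  apply commute_of_supports; auto using G_commutator. intros t.
  destruct (Rlt_dec t c); [right|left; apply Hwo; lra].
  apply commutator_trivial with x c; auto.
Qed.

(** A bump inside [(0, c)] that does not commute with [y] is the witness: it commutes with the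
    commutators attached to [x], which are the identity below [c]. *)
Lemma not_disjoint x y c t : G x -> G y -> c <= r -> (forall t, 0 < t < c -> x t <> t) ->
  0 < t < c -> y t <> t -> ~ disjoint x y.
Proof.
  intros Hx Hy Hc Hfree Ht Hyt D.
  destruct (noncommuting_bump y 0 t c) as (w & Hw & HC & Ho); auto; [lra|].
  apply HC, D; auto. apply commutes_with_commutators_free with c; auto.
Qed.

(** A noncommuting pair supported in [[l, m]] centralizes [x], and its commutator [k] is supported
    there too. If [w] threw [(l, m)] off itself, then [w (k s) = k (w s) = w s] would make [k]
    trivial. *)
Lemma commutes_with_commutators_fixed_interval x w l m : G x -> G w -> 0 <= l -> l < m ->
  m <= r ->
  (forall t, l < t < m -> x t = t) -> commutes_with_commutators x w -> ~ (forall s, l < s < m ->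
    w s <= l \/ m <= w s).
Proof.
  intros Hx Hw Hl Hlm Hm Hfix HH D.
  destruct (noncommuting_pair l m) as (a & b & Ha & Hb & HC & Ho); auto.
  assert (Hx' : forall a', G a' -> (forall s, s <= l \/ m <= s -> a' s = s) -> commute a' x).
  { intros a' Ha' Ho'. apply commute_of_supports; auto. intros s.
    destruct (Rle_dec s l); [left; auto|]. destruct (Rle_dec m s); [left; auto|].
    right. apply Hfix. lra. }
  assert (C : commute w (commutator a b)) by (apply HH; auto; apply Hx'; auto; intros; apply Ho;
    auto).
  assert (Hko : forall s, s <= l \/ m <= s -> commutator a b s = s).
  { intros s Hs. destruct (Ho s Hs). unfold commutator, Fmul. rewrite (inv_fix a), (inv_fix b);
    congruence. }
  apply HC, commuteE. intros s. set (k := commutator a b) in *.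
  assert (E : k (a (b s)) = b (a s)).
  { unfold k, commutator, Fmul. rewrite !inv_l; auto. }
  rewrite <- E. generalize (a (b s)). clear s E. intros s. symmetry.
  apply NNPP. intros N. destruct (Rle_dec s l); [apply N, Hko; auto|].
  destruct (Rle_dec m s); [apply N, Hko; auto|].
  apply (proj1 (commuteE _ _)) with (t := s) in C. rewrite Hko in C by (apply D; lra).
  apply G_inj in C; auto.
Qed.

Lemma moved_right y t : G y -> y t <> t -> exists m, t < m /\ forall s, t < s < m -> y s <> s.
Proof.
  intros Hy Hyt. destruct (Rtotal_order (y t) t) as [L|[|L]]; [|tauto|].
  - exists (inv y t). split; [apply inv_move; auto|]. intros s Hs.
    assert (X := G_incr y s (inv y t) Hy). rewrite inv_r in X by auto. lra.
  - exists (y t). split; auto. intros s Hs. assert (X := G_incr y t s Hy). lra.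
Qed.

Lemma moved_left y t : G y -> y t <> t -> exists m, m < t /\ forall s, m < s < t -> y s <> s.
Proof.
  intros Hy Hyt. destruct (Rtotal_order (y t) t) as [L|[|L]]; [|tauto|].
  - exists (y t). split; auto. intros s Hs. assert (X := G_incr y s t Hy). lra.
  - exists (inv y t). split; [apply inv_move'; auto|]. intros s Hs.
    assert (X := G_incr y (inv y t) s Hy). rewrite inv_r in X by auto. lra.
Qed.

(** If [w] and [y] both move [t], then next to [t], on the side of [w t], there is an interval all
    of whose points are moved by [y] and which [w] throws off itself. There [x] is the identity, so
    [w] cannot commute with the commutators attached to [x]. *)
Lemma disjoint_of_supports x y : G x -> G y -> (forall t, x t = t \/ y t = t) -> disjoint x y.
Proof.
  intros Hx Hy D w Hw HH. apply commute_of_supports; auto. intros t.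
  apply NNPP. intros N. apply not_or_and in N as [Nw Ny].
  assert (Ht : Iv r t) by (apply NNPP; intros X; apply Nw; apply (G_out); auto).
  assert (Hwt := G_Iv w t Hw Ht).
  assert (X : exists l m, 0 <= l /\ l < m /\ m <= r /\ (forall s, l < s < m -> y s <> s) /\
      forall s, l < s < m -> w s <= l \/ m <= w s).
  { unfold Iv in *. destruct (Rtotal_order (w t) t) as [L|[|L]]; [|tauto|].
    - destruct (moved_left y t Hy Ny) as (l & Hl & E).
      exists (Rmax l (w t)), t. assert (X := Rmax_l l (w t)). assert (Y := Rmax_r l (w t)).
      split; [lra|]. split; [apply Rmax_lub_lt; lra|]. split; [lra|].
      split; intros s Hs; [apply E; lra|]. left. assert (w s < w t) by (apply G_incr; auto; lra).
        lra.
    - destruct (moved_right y t Hy Ny) as (m & Hm & E).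
      exists t, (Rmin m (w t)). assert (X := Rmin_l m (w t)). assert (Y := Rmin_r m (w t)).
      split; [lra|]. split; [apply Rmin_glb_lt; lra|]. split; [lra|].
      split; intros s Hs; [apply E; lra|]. right. assert (w t < w s) by (apply G_incr; auto;
        lra). lra. }
  destruct X as (l & m & Hl & Hlm & Hm & Hy' & HD).
  apply (commutes_with_commutators_fixed_interval x w l m); auto.
  intros s Hs. destruct (D s); auto. exfalso. apply (Hy' s); auto.
Qed.

Lemma at_end_commutator e a b : G a -> G b ->
  at_end e (commutator a b) = commutator (at_end e a) (at_end e b).
Proof.
  intros. unfold commutator. rewrite !at_end_mul, !(at_end_inv) by auto. reflexivity.
Qed.

Lemma at_end_conjugate e p h : G h ->
  at_end e (conjugate p h) = conjugate (at_end e p) (at_end e h).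
Proof.
  intros. unfold conjugate. rewrite !at_end_mul, !(at_end_inv) by auto. reflexivity.
Qed.

Lemma disjoint_at_end e x y : disjoint x y -> disjoint (at_end e x) (at_end e y).
Proof.
  intros D w Hw HH. rewrite <- (at_endK e w). apply commute_at_end, D; auto.
  intros a Ha b Hb Ca Cb. rewrite <- (at_endK e (commutator a b)), at_end_commutator by auto.
  apply commute_at_end, HH; auto using commute_at_end.
Qed.

Lemma disjoint_expo e x y : G x -> G y -> disjoint x y -> expo e x <> 0%Z -> expo e y = 0%Z.
Proof.
  intros Hx Hy D Nx. apply (disjoint_at_end e) in D. apply NNPP. intros Ny.
  unfold expo in *. apply G_at_end with (e := e) in Hx, Hy.
  destruct (expo0_nonzero _ Hx Nx) as (d & Hd & E).
  destruct (expo0_nonzero _ Hy Ny) as (d' & Hd' & E').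
  assert (0 < Rmin d d') by (apply Rmin_glb_lt; lra).
  assert (Rmin d d' <= d) by apply Rmin_l. assert (Rmin d d' <= d') by apply Rmin_r.
  apply (not_disjoint (at_end e x) (at_end e y) d (Rmin d d' / 2)); auto; try lra.
  - intros; apply E; lra.
  - apply E'; lra.
Qed.

Lemma trivial_at_expo e p y : G p -> G y -> trivial_at p y -> expo e p <> 0%Z -> expo e y = 0%Z.
Proof.
  intros Hp Hy (h & hG & D) Np. destruct (Z.eq_dec (expo e y) 0) as [|Ny]; auto.
  assert (X := disjoint_expo e _ _ Hy (G_conjugate p h Hp hG) D Ny).
    rewrite expo_conjugate in X by auto. tauto.
Qed.

Lemma conjugate_fix p h t : G p -> G h -> p (inv h t) = inv h t -> conjugate p h t = t.
Proof. intros Hp hG E. unfold conjugate, Fmul. rewrite E, inv_r; auto. Qed.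

Lemma disjoint_separated x y s : G x -> G y ->
  (forall t, s <= t -> x t = t) -> (forall t, t <= s -> y t = t) -> disjoint x y /\ disjoint y x.
Proof.
  intros Hx Hy Ex Ey. split; apply disjoint_of_supports; auto; intros t;
    destruct (Rle_dec t s); auto; [left|right]; apply Ex; lra.
Qed.

Lemma conjugate_right_fix p h s t : G p -> G h -> (forall u, t <= u -> p u = u) -> h t <= s ->
  forall u, s <= u -> conjugate p h u = u.
Proof.
  intros Hp hG E Hs u Hu. apply conjugate_fix; auto. apply E.
  destruct (Rle_dec t (inv h u)) as [|N]; auto. exfalso.
  assert (X := G_incr h (inv h u) t hG). rewrite inv_r in X by auto. lra.
Qed.

(** [p] is the identity right of some [t < r], and [y] left of some [s > 0]; an element taking [t]
    below [s] conjugates [p] off the support of [y]. *)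
Lemma trivial_at_of_expo0 p y : G p -> G y -> expo false y = 0%Z -> expo true p = 0%Z ->
  trivial_at p y.
Proof.
  intros Hp Hy Ey Ep.
  destruct (expo0_zero y Hy Ey) as (s & Hs & Fy).
  destruct (expo_true_zero p Hp Ep) as (t & Ht & Fp).
  destruct (shrinking s t) as (h & hG & L); try lra.
  exists h. split; auto. apply (disjoint_separated (conjugate p h) y s); auto using G_conjugate.
  apply conjugate_right_fix with t; auto. lra.
Qed.

Lemma trivial_at_at_end e p y : trivial_at p y -> trivial_at (at_end e p) (at_end e y).
Proof.
  intros (h & hG & D). exists (at_end e h). split; auto.
  rewrite <- at_end_conjugate by auto. apply disjoint_at_end; auto.
Qed.

Lemma trivial_at_of_expo e p y : G p -> G y -> expo e y = 0%Z -> expo (negb e) p = 0%Z ->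
  trivial_at p y.
Proof.
  intros Hp Hy Ey Ep. rewrite <- (at_endK e p), <- (at_endK e y). apply trivial_at_at_end.
  apply trivial_at_of_expo0; auto; rewrite expo_at_end; destruct e; auto.
Qed.

(** * Pairs of elements marking the two ends *)

Definition Ends (e : bool) (p q : R -> R) : Prop :=
  expo e p <> 0%Z /\ expo (negb e) p = 0%Z /\ expo e q = 0%Z /\ expo (negb e) q <> 0%Z.

Lemma trivial_at_Ends e p q y : G p -> Ends e p q -> G y -> trivial_at p y <-> expo e y = 0%Z.
Proof.
  intros Hp (H1 & H2 & _) Hy. split; intros H.
  - apply trivial_at_expo with p; auto.
  - apply trivial_at_of_expo with e; auto.
Qed.

Lemma Ends_sym e p q : Ends e p q -> Ends (negb e) q p.
Proof. unfold Ends. rewrite Bool.negb_involutive. tauto. Qed.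

Lemma not_bounded p : G p -> ~ trivial_at p p -> exists e, expo e p <> 0%Z.
Proof.
  intros Hp N. destruct (Z.eq_dec (expo false p) 0) as [E|]; [|eauto].
  destruct (Z.eq_dec (expo true p) 0) as [E'|]; [|eauto].
  exfalso. apply N. apply trivial_at_of_expo with false; auto.
Qed.

Lemma end_pair_Ends p q : G p -> G q -> end_pair p q -> exists e, Ends e p q.
Proof.
  intros Hp Hq (Np & Nq & D).
  destruct (not_bounded p Hp Np) as (e & He). destruct (not_bounded q Hq Nq) as (e' & He').
  exists e. assert (E := disjoint_expo e p q Hp Hq D He).
  assert (E' : e' = negb e) by (destruct e, e'; simpl; auto; tauto). subst e'.
  split; auto. split; auto. apply NNPP. intros N.
  apply He'. apply disjoint_expo with p; auto.
Qed.

Lemma end_pair_exists : exists p q, G p /\ G q /\ end_pair p q.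
Proof.
  (* The bound [r / 4] keeps the support [[0, a + g * a]] in the left half, disjoint from its mirror
     image. *)
  destruct (A_dense 0 (r / 4)) as (a & HA & Ha); [lra|].
  set (p := bump 0 a g). set (q := at_end true p).
  assert (Hp : G p).
  { apply G_bump; auto; try nra; [apply A_0|].
    rewrite <- powerRZ_1. apply (Lam_pw). }
  assert (Hq : G q) by (apply G_at_end; auto).
  assert (Op : forall t, r / 2 <= t -> p t = t) by (intros; apply bump_out; nra).
  assert (Oq : forall t, t <= r / 2 -> q t = t).
  { intros t Ht. unfold q. simpl. unfold flip. rewrite Op by lra. ring. }
  assert (Cp : expo false p <> 0%Z).
  { assert (X : (0 < expo0 p)%Z); [|unfold expo; simpl; lia].
    apply (expo0_pos_of_lt) with a; auto; [lra|].
    intros t Ht. apply bump_lt; nra. }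
  assert (Cq : expo true q <> 0%Z) by (unfold q; rewrite expo_at_end; auto).
  exists p, q. do 2 (split; auto). split; [|split].
  - intros Z. apply Cp. apply trivial_at_expo with p; auto.
  - intros Z. apply Cq. apply trivial_at_expo with q; auto.
  - apply (disjoint_separated p q (r / 2)); auto.
Qed.

(** * Centralizers of bumps *)

Section Root.

Variables (k : Z) (a : R).
Hypothesis k_pos : (0 < k)%Z.
Hypothesis HAa : A a.
Hypothesis a_pos : 0 < a.
Let l := powerRZ g k.
Let c := a + l * a.
Hypothesis c_le : c <= r.
Let u := bump 0 a l.

Let l_pos : 0 < l := pw_pos k.
Let l_lt_1 : l < 1 := pw_lt_1 k k_pos.
Let la_pos : 0 < l * a := Rmult_lt_0_compat _ _ l_pos a_pos.

Lemma root_G : G u.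
Proof.
  apply G_bump; auto; try lra.
  - apply A_0.
  - apply (Lam_pw).
  - unfold c in *. lra.
Qed.

Lemma root_left t : 0 <= t <= a -> u t = l * t.
Proof. intros Ht. unfold u. rewrite bump_left by lra. ring. Qed.

Lemma root_right z : 0 <= z <= l * a -> u (c - z) = c - z / l.
Proof.
  intros Hz. unfold u, c. rewrite bump_right by lra. field. lra.
Qed.

Lemma root_expo0 : expo0 u = k.
Proof.
  apply (expo0_eq). exists (Rmin a r).
  assert (X := Rmin_l a r). assert (Y := Rmin_r a r).
  split; [split; auto; apply Rmin_glb_lt; auto|].
  intros t Ht. apply root_left. lra.
Qed.

(** Elements commuting with [u] permute its fixed points, and there are none between 0 and [c];
    hence neither [v] nor its inverse lowers [c]. *)
Lemma root_fixes_c v : G v -> commute v u -> v c = c.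
Proof.
  intros Hv C.
  assert (Hu : u c = c) by (apply bump_out; unfold c; lra).
  assert (X : forall z, G z -> commute z u -> z c < c -> False).
  { intros z Hz Cz L. assert (E := proj1 (commuteE _ _) Cz c). rewrite Hu in E.
    assert (0 < z c). { rewrite <- (G_0 z Hz). apply G_incr; auto. unfold c; lra. }
    assert (B := bump_lt 0 a l (z c)). unfold u, c in *. lra. }
  destruct (Rtotal_order (v c) c) as [L|[|L]]; auto; exfalso.
  - apply (X v); auto.
  - apply (X (inv v)); auto using inv_move', commute_inv.
Qed.

(** On [[0, a]] the map [u] multiplies by [l], so its iterates bring any point near 0, where [v] is
    known to be linear; commutation carries the formula back. The slope of [v] is below 1, which
    keeps images inside [[0, a]]. *)
Lemma root_linear_left v j : G v -> commute v u -> (0 < j)%Z -> expo0 v = j ->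
  forall t, 0 <= t <= a -> v t = powerRZ g j * t.
Proof.
  intros Hv C Hj E. set (m := powerRZ g j).
  assert (Hm : 0 < m) by (apply pw_pos; auto). assert (Hm1 : m < 1) by (apply pw_lt_1; auto).
  destruct (expo0_germ v Hv) as (d & Hd & F). rewrite E in F. fold m in F.
  assert (X : forall n t, 0 <= t <= a -> l ^ n * t <= d -> v t = m * t).
  { induction n as [|n IH]; intros t Ht Hn.
    - apply F. simpl in Hn. lra.
    - apply (G_inj u); auto using root_G. rewrite (proj1 (commuteE _ _) C).
      rewrite root_left by auto. rewrite root_left by nra.
      rewrite IH; [ring|nra|]. simpl in Hn. lra. }
  intros t Ht. destruct (pow_lt_1_zero l) with (y := d / a) as (N & HN).
  { rewrite Rabs_right; lra. }
  { apply Rdiv_lt_0_compat; lra. }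
  apply (X N); auto. specialize (HN N (le_n N)).
  assert (P : 0 < l ^ N) by (apply pow_lt; auto). rewrite Rabs_right in HN by lra.
  apply Rle_trans with (l ^ N * a); [apply Rmult_le_compat_l; lra|].
  replace d with (d / a * a) by (field; lra). apply Rmult_le_compat_r; lra.
Qed.

(** The same transport at the fixed point [c], towards which the inverse of [u] contracts. The
    bounds on [z] and [n * z] keep the point and its image where that inverse is affine. *)
Lemma root_linear_right v : G v -> commute v u ->
  exists n, 0 < n /\ forall z, 0 <= z <= a -> n * z <= a -> v (c - z) = c - n * z.
Proof.
  intros Hv C. assert (Hc := root_fixes_c v Hv C).
  assert (Hpl := proj1 (InF_pl v) Hv). destruct Hpl as (_ & _ & Hpl).
  destruct (pl_left_germ _ _ _ Hpl c) as (d & n & Hd & Hn & _ & F); [unfold c in *; lra|].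
  apply Lam_pos in Hn. rewrite Hc in F.
  exists n. split; auto.
  assert (X : forall i z, 0 <= z <= a -> n * z <= a -> l ^ i * z <= d -> v (c - z) = c - n * z).
  { induction i as [|i IH]; intros z Hz Hnz Hi.
    - rewrite F by (simpl in Hi; lra). ring.
    - assert (Hlz : 0 <= l * z <= l * a) by nra.
      assert (Hlnz : 0 <= l * (n * z) <= l * a) by (assert (0 <= n * z) by nra; nra).
      assert (E1 : u (c - l * z) = c - z) by (rewrite root_right by auto; field; lra).
      assert (E2 : u (c - l * (n * z)) = c - n * z) by (rewrite root_right by auto; field; lra).
      rewrite <- E1, <- E2, <- (proj1 (commuteE _ _) C). f_equal.
      rewrite IH; [ring|nra|nra|]. simpl in Hi. lra. }
  intros z Hz Hnz. destruct (pow_lt_1_zero l) with (y := d / a) as (N & HN).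
  { rewrite Rabs_right; lra. }
  { apply Rdiv_lt_0_compat; lra. }
  apply (X N); auto. specialize (HN N (le_n N)).
  assert (P : 0 < l ^ N) by (apply pow_lt; auto). rewrite Rabs_right in HN by lra.
  apply Rle_trans with (l ^ N * a); [apply Rmult_le_compat_l; lra|].
  replace d with (d / a * a) by (field; lra). apply Rmult_le_compat_r; lra.
Qed.

(* An element commuting with [u] is linear on [[0, a]] and affine near [c], and both
   pieces overlap around [a] when its slope at [0] lies strictly between [l] and [1];
   hence it is linear on [[0, c]] and fixes [c], which is absurd. *)
Lemma root_no_intermediate v : G v -> commute v u -> ~ (0 < expo0 v < k)%Z.
Proof.
  intros Hv C [H1 H2].
  assert (FL := root_linear_left v (expo0 v) Hv C H1 eq_refl).
  destruct (root_linear_right v Hv C) as (n & Hn & FR).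
  set (m := powerRZ g (expo0 v)) in *.
  assert (Hml : l < m) by (apply pw_lt; auto).
  assert (Hm1 : m < 1) by (apply pw_lt_1; auto).
  assert (Ea : v a = m * a) by (apply FL; lra).
  assert (Hma : l * a < m * a) by (apply Rmult_lt_compat_r; auto).
  assert (Hla : l * a < a) by nra.
  destruct (Rle_dec (n * (l * a)) a) as [Hna|Hna].
  - assert (E1 := FR (l * a) ltac:(lra) Hna).
    replace (c - l * a) with a in E1 by (unfold c; ring). rewrite Ea in E1.
    assert (Hna' : n * (l * a) < a) by (unfold c in *; lra).
    set (e := Rmin (a - l * a) ((a - n * (l * a)) / n)).
    assert (He : 0 < e) by (apply Rmin_glb_lt; [lra|apply Rdiv_lt_0_compat; lra]).
    assert (He1 : e <= a - l * a) by apply Rmin_l.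
    assert (He2 : n * e <= a - n * (l * a)).
    { replace (a - n * (l * a)) with (n * ((a - n * (l * a)) / n)) by (field; lra).
      apply Rmult_le_compat_l; [lra|apply Rmin_r]. }
    assert (E2 : v (c - (l * a + e)) = c - n * (l * a + e)) by (apply FR; lra).
    replace (c - (l * a + e)) with (a - e) in E2 by (unfold c; ring).
    rewrite FL in E2 by lra.
    assert (Emn : m = n) by (apply Rmult_eq_reg_r with e; lra).
    rewrite <- Emn in E1. assert (Ec : (1 - m) * c = 0) by (unfold c in *; lra).
    assert (0 < (1 - m) * c) by (apply Rmult_lt_0_compat; unfold c; lra). lra.
  (* Here the affine range at [c] ends right of [a]: at its edge [c - a / n] the value of [v] is
     [c - a = l * a], less than [v a = m * a], against monotonicity. *)
  - assert (Hz : a / n < l * a).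
    { apply Rmult_lt_reg_l with n; auto. replace (n * (a / n)) with a by (field; lra). lra. }
    assert (Hz0 : 0 < a / n) by (apply Rdiv_lt_0_compat; lra).
    assert (E : v (c - a / n) = c - n * (a / n)).
    { apply FR; [lra|]. right. field. lra. }
    replace (n * (a / n)) with a in E by (field; lra).
    assert (X := G_incr v a (c - a / n) Hv). unfold c in *. lra.
Qed.

(** Multiplying [v] by a power of [u] reduces its exponent to the remainder modulo [k], which cannot
    lie strictly between 0 and [k]. *)
Lemma root_centralizer v : G v -> commute v u -> (k | expo0 v)%Z.
Proof.
  intros Hv C. destruct (commute_power u u root_G root_G (commute_refl u) (- (expo0 v / k))) as (w & Hw & Cw & E).
  assert (X := root_no_intermediate (Fmul v w) (G_mul v w Hv Hw) (commute_mul v w u C Cw)).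
  specialize (E false). assert (Y := expo_mul false v w Hv Hw). rewrite E in Y.
  unfold expo in Y. simpl in Y. rewrite root_expo0 in Y. rewrite Y in X.
  assert (D := Z.div_mod (expo0 v) k). assert (B := Z.mod_pos_bound (expo0 v) k k_pos).
  exists (expo0 v / k)%Z. nia.
Qed.

End Root.

Lemma root_exists e k : (0 < k)%Z ->
  exists w, G w /\ expo e w = k /\ forall v, G v -> commute v w -> (k | expo e v)%Z.
Proof.
  intros Hk. assert (Hl := pw_pos k). set (l := powerRZ g k) in *.
  destruct (A_dense 0 (r / (1 + l))) as (a & HA & Ha1 & Ha2).
  { apply Rdiv_lt_0_compat; lra. }
  assert (Hc : a + l * a <= r).
  { replace r with (r / (1 + l) * (1 + l)) by (field; lra). nra. }
  exists (at_end e (bump 0 a l)). split; [|split].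
  - apply G_at_end, root_G; auto.
  - unfold expo. rewrite at_endK. apply root_expo0; auto.
  - intros v Hv C. apply (root_centralizer k a); auto using G_at_end.
    rewrite <- (at_endK e (bump 0 a _)). apply commute_at_end. exact C.
Qed.

(** * Fixed-point free elements *)

Definition fixed_point_free (u : R -> R) : Prop := forall t, 0 < t < r -> u t <> t.

Lemma fixed_point_free_at_end e u : fixed_point_free u -> fixed_point_free (at_end e u).
Proof.
  destruct e; auto. intros F t Ht E. apply (F (r - t)); [lra|].
  simpl in E. unfold flip in E. lra.
Qed.

Lemma fixed_point_free_inv u : G u -> fixed_point_free u -> fixed_point_free (inv u).
Proof.
  intros Hu F t Ht E. apply (F t Ht). rewrite <- E at 1. apply inv_r; auto.
Qed.

(** Let [b] be the supremum of the points that the centralizer of [u] carries below [s]. If [b < r],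
    then [u] or its inverse lowers [b]; following it by an element that works just left of [b]
    handles points beyond [b]. *)
Lemma fixed_point_free_moves u s t : G u -> fixed_point_free u -> 0 < s -> t < r ->
  exists v, G v /\ commute v u /\ v t < s.
Proof.
  intros Hu F Hs Ht.
  set (E := fun t => t < r /\ exists v, G v /\ commute v u /\ v t < s).
  assert (E0 : E (Rmin (s / 2) (r / 2))).
  { assert (X := Rmin_l (s / 2) (r / 2)). assert (Y := Rmin_r (s / 2) (r / 2)).
    split; [lra|]. exists Fone. split; [apply G_one|]. split; [apply commute_one|]. unfold Fone.
      lra. }
  destruct (completeness E) as (b & Hub & Hlub).
  { exists r. intros b Hb. left. apply Hb. }
  { eauto. }
  assert (Hb : 0 < b).
  { apply Rlt_le_trans with (Rmin (s / 2) (r / 2)); [apply Rmin_glb_lt; lra|apply Hub; auto]. }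
  assert (Hbr : b <= r) by (apply Hlub; intros b' Hb'; left; apply Hb').
  assert (Hdown : forall t', t' < b -> exists v, G v /\ commute v u /\ v t' < s).
  { intros t' Ht'. apply NNPP. intros N. apply Rlt_not_le in Ht'. apply Ht', Hlub.
    intros t'' (_ & v & Hv & C & L). destruct (Rle_dec t'' t') as [|Hle]; auto.
    exfalso. apply N. exists v. do 2 (split; auto).
    assert (X := G_incr v t' t'' Hv). lra. }
  destruct Hbr as [Hbr| ->]; [|apply Hdown; lra]. exfalso.
  assert (X : forall z, G z -> commute z u -> z b < b -> False).
  { intros z Hz Cz L. set (t' := (z b + b) / 2).
    destruct (Hdown t') as (v & Hv & Cv & Lv); [unfold t'; lra|].
    assert (HE : E (inv z t')).
    { split.
      - apply (G_incr_inv z); auto. rewrite inv_r by auto.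
        rewrite (G_ge_r z r) by (auto; lra). unfold t'. lra.
      - exists (Fmul z v). split; auto using G_mul. split; [apply commute_mul; auto|].
        unfold Fmul. rewrite inv_r; auto. }
    apply Hub in HE. revert HE. apply Rlt_not_le.
    apply (G_incr_inv z); auto. rewrite inv_r by auto. unfold t'. lra. }
  destruct (Rtotal_order (u b) b) as [L|[L|L]].
  - apply (X u); auto. apply commute_refl.
  - apply (F b); lra.
  - apply (X (inv u)); auto using inv_move'. apply commute_inv; auto. apply commute_refl.
Qed.

Lemma fixed_point_free_full_support0 u w y : G u -> fixed_point_free u -> G w -> G y ->
  expo true w = 0%Z -> expo false y = 0%Z ->
  exists v, G v /\ commute v u /\ disjoint (conjugate w v) y.
Proof.
  intros Hu F Hw Hy Ew Ey.
  destruct (expo0_zero y Hy Ey) as (s & Hs & Fy).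
  destruct (expo_true_zero w Hw Ew) as (t & Ht & Fw).
  destruct (fixed_point_free_moves u s t) as (v & Hv & C & L); auto; try lra.
  exists v. do 2 (split; auto).
  apply (disjoint_separated (conjugate w v) y s); auto using G_conjugate.
  apply conjugate_right_fix with t; auto. lra.
Qed.

(** Suppose [u] fixes [b] and moves all points of [(0, d]]. An element commuting with [u] sends [b]
    to a fixed point of [u], hence beyond [d]. So a support reaching from 0 past [b] still covers
    [(0, d)] after being pushed, and never leaves the support of [y']. *)
Lemma full_support_fixed_point_free0 u : G u -> expo0 u <> 0%Z ->
  (forall w y, G w -> G y -> expo true w = 0%Z -> expo false y = 0%Z ->
    exists v, G v /\ commute v u /\ disjoint (conjugate w v) y) -> fixed_point_free u.
Proof.
  intros Hu N F b Hb Eb.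
  destruct (expo0_nonzero u Hu N) as (d & Hd & Fd).
  assert (Hdb : d < b) by (destruct (Rlt_dec d b); auto; exfalso; apply (Fd b); lra).
  destruct (bump_exists (d / 4) (d / 2) d) as (y' & Hy' & Hyd' & Yo'); try lra.
  destruct (A_dense (b / (1 + g)) (r / (1 + g))) as (a & HA & Ha1 & Ha2).
  { apply Rmult_lt_compat_r; [apply Rinv_0_lt_compat|]; lra. }
  assert (H1 : b < a + g * a).
  { replace b with (b / (1 + g) * (1 + g)) by (field; lra). nra. }
  assert (H2 : a + g * a < r).
  { replace r with (r / (1 + g) * (1 + g)) by (field; lra). nra. }
  assert (Ha : 0 < a) by nra.
  set (w := bump 0 a g) in *. set (c := a + g * a) in *.
  assert (Hw : G w).
  { apply G_bump; auto; try lra; [apply A_0| |unfold c in *; lra].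
    rewrite <- powerRZ_1. apply Lam_pw. }
  assert (Wo : forall t, c <= t -> w t = t) by (intros; apply bump_out; unfold c in *; lra).
  assert (Wi : forall t, 0 < t < c -> w t < t) by (intros; apply bump_lt; unfold c in *; lra).
  destruct (F w y') as (v & Hv & C & D); auto.
  { unfold expo. simpl. apply expo0_zero_of_fix with (r - c); auto using G_flip; [lra|].
    intros t Ht. unfold flip. rewrite Wo by lra. ring. }
  { apply expo0_zero_of_fix with (d / 4); auto; [lra|]. intros t Ht. apply Yo'. lra. }
  assert (Hvb : d < v b).
  { destruct (Rlt_dec d (v b)); auto. exfalso. apply (Fd (v b)).
    - split; [|lra]. rewrite <- (G_0 v Hv). apply G_incr; auto. lra.
    - rewrite (proj1 (commuteE _ _) C), Eb. auto. }
  assert (Hvc : v b < v c) by (apply G_incr; auto).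
  revert D. apply not_disjoint with (c := d) (t := d / 2); auto using G_conjugate; try lra.
  intros t Ht E. unfold conjugate, Fmul in E.
  assert (E' : w (inv v t) = inv v t) by (apply (G_inj v); auto; rewrite inv_r; auto).
  assert (X : w (inv v t) < inv v t); [|lra].
  apply Wi. split.
  - apply (G_incr_inv v); auto. rewrite inv_r, (G_0 v); auto. lra.
  - apply (G_incr_inv v); auto. rewrite inv_r; auto. lra.
Qed.

(** The condition on the exponent of [u] excludes elements such as the identity, whose centralizer
    is the whole group and pushes any support. *)
Lemma full_support_fixed_point_free e p q u : G p -> G q -> Ends e p q -> G u ->
  expo e u <> 0%Z ->
  full_support p q u <-> fixed_point_free u.
Proof.
  intros Hp Hq He Hu Nu.
  assert (Zp := fun y => trivial_at_Ends e p q y Hp He).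
  assert (Zq := fun y => trivial_at_Ends (negb e) q p y Hq (Ends_sym _ _ _ He)).
  split; intros F.
  - rewrite <- (at_endK e u). apply fixed_point_free_at_end.
    apply full_support_fixed_point_free0; auto using G_at_end.
    intros w y Hw Hy Ew Ey.
    destruct (F (at_end e w) (G_at_end e w Hw) (at_end e y) (G_at_end e y Hy)) as (v & Hv & C & D).
    + apply Zq; auto using G_at_end. rewrite expo_at_end. destruct e; auto.
    + apply Zp; auto using G_at_end. rewrite expo_at_end. destruct e; auto.
    + exists (at_end e v). split; auto using G_at_end. split; [apply commute_at_end; auto|].
      apply (disjoint_at_end e) in D. rewrite at_end_conjugate, !at_endK in D by auto. exact D.
  - intros w Hw y Hy Ew Ey. apply Zq in Ew; auto. apply Zp in Ey; auto.
    destruct (fixed_point_free_full_support0 (at_end e u) (at_end e w) (at_end e y)) as (v & Hv & C & D);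
      auto using G_at_end, fixed_point_free_at_end; try (rewrite expo_at_end; destruct e; auto).
    exists (at_end e v). split; auto using G_at_end. split.
    + rewrite <- (at_endK e u). apply commute_at_end; auto.
    + apply (disjoint_at_end e) in D. rewrite at_end_conjugate, !at_endK in D by auto. exact D.
Qed.

Lemma fixed_point_free_constant_direction u s t : G u -> fixed_point_free u -> 0 < s < r ->
  0 < t < r -> u s < s -> u t < t.
Proof.
  intros Hu F Hs Ht Ls. apply NNPP. intros N.
  assert (Lt : t < u t) by (assert (X := F t Ht); lra). clear N.
  (* An intermediate value argument: the supremum of the points of [[a, b]] that [z] does not lower
     is fixed. If [u] moves down first and up later, it is applied to the inverse. *)
  assert (X : forall z a b, G z -> 0 < a -> a < b -> b < r -> a < z a -> z b < b ->
    exists c, 0 < c < r /\ z c = c).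
  { intros z a b Hz Ha Hab Hb La Lb.
    set (E := fun c => a <= c <= b /\ c <= z c).
    destruct (completeness E) as (c & Hub & Hlub).
    { exists b. intros c Hc. apply Hc. }
    { exists a. split; lra. }
    assert (Hac : a <= c) by (apply Hub; split; lra).
    assert (Hcb : c <= b) by (apply Hlub; intros c' Hc'; apply Hc').
    assert (Hmon : forall x y, x <= y -> z x <= z y).
    { intros x y [L| ->]; [|lra]. left. apply G_incr; auto. }
    assert (H1 : c <= z c).
    { apply Hlub. intros c' Hc'. assert (c' <= c) by (apply Hub; auto).
      apply Rle_trans with (z c'); [apply Hc'|apply Hmon; auto]. }
    assert (H2 : z c <= c).
    { apply Hub. split; [|apply Hmon; auto]. specialize (Hmon c b Hcb). lra. }
    exists c. lra. }
  destruct (Rtotal_order s t) as [L|[->|L]]; [|lra|].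
  - destruct (X (inv u) s t) as (c & Hc & Ec); auto using G_inv; try lra.
    + apply inv_move; auto.
    + apply inv_move'; auto.
    + apply (fixed_point_free_inv u Hu F c Hc Ec).
  - destruct (X u t s) as (c & Hc & Ec); auto; try lra. apply (F c Hc Ec).
Qed.

Lemma fixed_point_free_sign u : G u -> fixed_point_free u ->
  (0 < expo false u /\ expo true u < 0)%Z \/ (expo false u < 0 /\ 0 < expo true u)%Z.
Proof.
  assert (X : forall u, G u -> fixed_point_free u -> u (r / 2) < r / 2 -> (0 < expo false u /\
    expo true u < 0)%Z).
  { clear u. intros u Hu F L.
    assert (D : forall t, 0 < t < r -> u t < t)
      by (intros t Ht; apply (fixed_point_free_constant_direction u (r / 2)); auto; lra).
    split.
    - apply expo0_pos_of_lt with r; auto.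
    - assert (P : (0 < expo true (inv u))%Z); [|rewrite expo_inv in P by auto; lia].
      unfold expo. simpl. apply expo0_pos_of_lt with r; auto using G_inv, G_flip.
      intros t Ht. unfold flip. assert (r - t < inv u (r - t)); [|lra].
      apply inv_move; auto. apply D. lra. }
  intros Hu F. destruct (Rtotal_order (u (r / 2)) (r / 2)) as [L|[L|L]].
  - left. apply X; auto.
  - exfalso. apply (F (r / 2)); lra.
  - right. destruct (X (inv u)); auto using G_inv, fixed_point_free_inv.
    + apply inv_move'; auto.
    + rewrite expo_inv in * by auto. lia.
Qed.

(** Two bumps, one starting at 0 with slope [g^k] and one ending at [r], have overlapping supports
    that cover [(0, r)]. Both move points down, hence so does their product, and each end sees only
    one of them. *)
Lemma fixed_point_free_exists_pos k : (0 < k)%Z ->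
  exists u, G u /\ fixed_point_free u /\ expo false u = k /\ expo true u = (-1)%Z.
Proof.
  intros Hk.
  destruct (A_dense (r / 2 / (1 + g)) (r / (1 + g))) as (a & HA & Ha1 & Ha2).
  { apply Rmult_lt_compat_r; [apply Rinv_0_lt_compat|]; lra. }
  assert (H1 : r / 2 < a + g * a).
  { replace (r / 2) with (r / 2 / (1 + g) * (1 + g)) by (field; lra). nra. }
  assert (H2 : a + g * a < r).
  { replace r with (r / (1 + g) * (1 + g)) by (field; lra). nra. }
  assert (Ha : 0 < a) by nra. set (c := a + g * a) in *.
  assert (Hl := pw_pos k). assert (Hl1 := pw_lt_1 k Hk). set (l := powerRZ g k) in *.
  destruct (A_dense ((r - c) / (1 + l)) (r / (1 + l))) as (b & HB & Hb1 & Hb2).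
  { apply Rmult_lt_compat_r; [apply Rinv_0_lt_compat|unfold c]; nra. }
  assert (H3 : r - c < b + l * b).
  { replace (r - c) with ((r - c) / (1 + l) * (1 + l)) by (field; lra). nra. }
  assert (H4 : b + l * b < r).
  { replace r with (r / (1 + l) * (1 + l)) by (field; lra). nra. }
  assert (Hb : 0 < b) by nra.
  set (x := bump 0 b l). set (y := bump (r - c) a g).
  assert (Hx : G x) by (apply G_bump; auto; try lra; [apply A_0|apply Lam_pw]).
  assert (Lg : Lam g) by (rewrite <- powerRZ_1; apply Lam_pw).
  assert (Hy : G y).
  { apply G_bump; auto; [|lra|unfold c; lra]. apply A_sub; [apply A_r|].
    unfold c. apply A_add; auto. apply A_scal; auto. }
  assert (Xle : forall t, x t <= t).
  { intros t. destruct (Rle_dec t 0); [unfold x; rewrite bump_out; lra|].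
    destruct (Rle_dec (b + l * b) t); [unfold x; rewrite bump_out; lra|].
    left. apply bump_lt; lra. }
  assert (Yle : forall t, y t <= t).
  { intros t. destruct (Rle_dec t (r - c)); [unfold y; rewrite bump_out; lra|].
    destruct (Rle_dec r t); [unfold y; rewrite bump_out; unfold c in *; lra|].
    left. apply bump_lt; unfold c in *; lra. }
  exists (Fmul x y). split; auto using G_mul. split; [|split].
  - intros t Ht. assert (Fmul x y t < t); [|lra]. unfold Fmul.
    destruct (Rlt_dec t (b + l * b)).
    + assert (x t < t) by (apply bump_lt; lra). specialize (Yle (x t)). lra.
    + replace (x t) with t by (symmetry; apply bump_out; lra). apply bump_lt; unfold c in *; lra.
  - rewrite expo_mul by auto. unfold expo. simpl.
    rewrite (expo0_zero_of_fix y (r - c)); auto; [|lra|intros; apply bump_out; lra].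
    unfold x, l. rewrite root_expo0; auto. lia.
  - rewrite expo_mul by auto.
    assert (Ex : expo true x = 0%Z).
    { unfold expo. simpl. apply expo0_zero_of_fix with (r - (b + l * b)); auto using G_flip;
      [lra|].
      intros t Ht. unfold flip, x. rewrite bump_out by lra. ring. }
    assert (Ey : expo true y = (-1)%Z); [|lia].
    apply expo0_eq. exists (Rmin r (g * a)). assert (Z1 := Rmin_l r (g * a)).
    assert (Z2 := Rmin_r r (g * a)). split; [split; auto; apply Rmin_glb_lt; nra|].
    intros t Ht. simpl. unfold flip, y. rewrite bump_right by (unfold c; lra).
    unfold c. field. lra.
Qed.

Lemma fixed_point_free_exists e k : k <> 0%Z ->
  exists u, G u /\ fixed_point_free u /\ expo e u = k /\ expo (negb e) u = (- Z.sgn k)%Z.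
Proof.
  intros Hk. destruct (fixed_point_free_exists_pos (Z.abs k)) as (u & Hu & F & E1 & E2); [lia|].
  assert (Hu' : G (at_end e u)) by (apply G_at_end; auto).
  assert (E1' : expo e (at_end e u) = Z.abs k) by (rewrite expo_at_end; destruct e; auto).
  assert (E2' : expo (negb e) (at_end e u) = (-1)%Z) by (rewrite expo_at_end; destruct e; auto).
  destruct (Z.lt_total k 0) as [L|[|L]]; [|tauto|].
  - exists (inv (at_end e u)). rewrite !expo_inv by auto. split; auto using G_inv.
    split; [apply fixed_point_free_inv; auto using fixed_point_free_at_end|]. lia.
  - exists (at_end e u). split; auto. split; [apply fixed_point_free_at_end; auto|]. lia.
Qed.

(** The product of [v] with a suitable power of [u] is the identity near 0, hence everywhere, so [v]
    is a power of [u]. *)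
Lemma fixed_point_free_centralizer u v : G u -> fixed_point_free u ->
  Z.abs (expo false u) = 1%Z -> Z.abs (expo true u) = 1%Z ->
  G v -> commute v u -> Z.abs (expo false v) = Z.abs (expo true v).
Proof.
  intros Hu F E0 E1 Hv C.
  (* The exponent of [u] at 0 squares to 1, so this power cancels the exponent of [v] there. *)
  destruct (commute_power u u Hu Hu (commute_refl u) (- (expo false v * expo false u))) as (w & Hw & Cw & Ew).
  assert (Ht : forall t, t < r -> Fmul v w t = t).
  { destruct (expo0_zero (Fmul v w)) as (d & Hd & Fd); auto using G_mul.
    - assert (X := expo_mul false v w Hv Hw). rewrite Ew in X. unfold expo in *. simpl in *.
      rewrite X. nia.
    - apply fixed_spreads with u d; auto using G_mul; [apply commute_mul; auto|lra|].
      intros t Ht. apply Fd. lra. }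
  assert (X : expo true (Fmul v w) = 0%Z).
  { unfold expo. simpl. apply expo0_zero_of_fix with r; auto using G_flip, G_mul.
    intros t Ht'. unfold flip. rewrite Ht by lra. ring. }
  rewrite expo_mul, Ew in X by auto. nia.
Qed.

(** * Divisibility, addition and multiplication of exponents *)

Definition eq_expo (p x y : R -> R) : Prop := trivial_at p (Fmul x (inv y)).
(** Quantifying over [w] amounts to quantifying over subgroups of [Z]: each one that contains the
    exponent of [x] must contain that of [y]. *)
Definition div_expo (p x y : R -> R) : Prop :=
  forall w, G w -> (exists v, G v /\ commute v w /\ eq_expo p v x) -> exists v, G v /\
    commute v w /\ eq_expo p v y.
Definition gen_expo (p x : R -> R) : Prop := forall y, G y -> div_expo p x y.
(** A fixed-point free element has exponents of opposite signs at the two ends. As [u] and [v] agree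
    at the end of [q], their signs agree at the end of [p]. *)
Definition same_sign (p q x y : R -> R) : Prop :=
  ~ trivial_at p x /\ ~ trivial_at p y /\
  exists u, G u /\ exists v, G v /\
    full_support p q u /\ full_support p q v /\ eq_expo p u x /\ eq_expo p v y /\ eq_expo q u v.
Definition eq_abs_expo (p x y : R -> R) : Prop := eq_expo p x y \/ trivial_at p (Fmul x y).
Definition add_abs_expo (p q x y z : R -> R) : Prop :=
  (trivial_at p x /\ eq_abs_expo p z y) \/ (trivial_at p y /\ eq_abs_expo p z x) \/
  exists x', G x' /\ exists y', G y' /\
    eq_abs_expo p x' x /\ eq_abs_expo p y' y /\ same_sign p q x' y' /\
      eq_abs_expo p z (Fmul x' y').
Definition lcm_expo (p x y m : R -> R) : Prop :=
  forall w, G w -> (div_expo p x w /\ div_expo p y w -> div_expo p m w) /\ (div_expo p m w ->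
    div_expo p x w /\ div_expo p y w).
(** If [o] has exponent 1 or -1, the lcm of [x] and [x + o] is their product up to sign. The
    equations |y + x| = |x (x + o)| and |y - x| = |x (x - o)| together leave only y = o x^2. *)
Definition square_expo (p o x y : R -> R) : Prop :=
  lcm_expo p x (Fmul x o) (Fmul y x) /\ lcm_expo p x (Fmul x (inv o)) (Fmul y (inv x)).
(** Polarization: o (x + y)^2 = o x^2 + o y^2 + 2 z' gives z' = o x y, whose absolute value is that
    of x y. *)
Definition mul_abs_expo (p x y z : R -> R) : Prop :=
  exists o, G o /\ exists a, G a /\ exists b, G b /\ exists c, G c /\ exists z', G z' /\
    gen_expo p o /\ square_expo p o x a /\ square_expo p o y b /\ square_expo p o (Fmul x y) c /\
    eq_abs_expo p z' z /\ eq_expo p c (Fmul (Fmul a b) (Fmul z' z')).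

Lemma expo_surj e k : exists x, G x /\ expo e x = k.
Proof.
  destruct (Z.eq_dec k 0) as [->|N].
  - exists Fone. split; [apply G_one|apply expo_one].
  - destruct (fixed_point_free_exists e k N) as (u & Hu & _ & E & _). eauto.
Qed.

Section AtAnEnd.

Variables (e : bool) (p q : R -> R).
Hypotheses (Hp : G p) (Hq : G q) (Hpq : Ends e p q).

Lemma trivial_atE y : G y -> trivial_at p y <-> expo e y = 0%Z.
Proof. apply trivial_at_Ends with q; auto. Qed.

Lemma eq_expoE x y : G x -> G y -> eq_expo p x y <-> expo e x = expo e y.
Proof.
  intros Hx Hy. unfold eq_expo. rewrite trivial_atE, expo_mul, expo_inv by auto. lia.
Qed.

Lemma eq_expo_other_endE x y : G x -> G y -> eq_expo q x y <-> expo (negb e) x = expo (negb e) y.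
Proof.
  intros Hx Hy. unfold eq_expo. rewrite (trivial_at_Ends (negb e) q p) by auto using Ends_sym.
  rewrite expo_mul, expo_inv by auto. lia.
Qed.

Lemma eq_abs_expoE x y : G x -> G y -> eq_abs_expo p x y <-> Z.abs (expo e x) = Z.abs (expo e y).
Proof.
  intros Hx Hy. unfold eq_abs_expo. rewrite eq_expoE, trivial_atE, expo_mul by auto. lia.
Qed.

Lemma div_expoE x y : G x -> G y -> div_expo p x y <-> (expo e x | expo e y)%Z.
Proof.
  intros Hx Hy. split.
  - intros D.
    assert (X : forall k, (0 < k)%Z -> (k | expo e x)%Z -> (k | expo e y)%Z).
    { intros k Hk [z Hz]. destruct (root_exists e k Hk) as (w & Hw & Ew & C).
      destruct (D w Hw) as (v & Hv & Cv & Ev).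
      - destruct (commute_power w w Hw Hw (commute_refl w) z) as (v & Hv & Cv & Ev).
        exists v. do 2 (split; auto). apply eq_expoE; auto. rewrite Ev, Ew. auto.
      - apply eq_expoE in Ev; auto. rewrite <- Ev. auto. }
    destruct (Z.eq_dec (expo e x) 0) as [E|N].
    (* With exponent 0 for [x], every positive integer divides the exponent of [y]; one exceeding
       its absolute value forces it to be 0. *)
    + rewrite E in *. specialize (X (Z.abs (expo e y) + 1)%Z ltac:(lia) (Z.divide_0_r _)).
      replace (expo e y) with 0%Z; [apply Z.divide_0_r|]. symmetry.
      destruct (Z.eq_dec (expo e y) 0) as [|N]; auto.
      apply Z.divide_abs_r, Z.divide_pos_le in X; lia.
    + apply Z.divide_abs_l, X; [lia|]. apply Z.divide_abs_l, Z.divide_refl.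
  - intros [z Hz] w Hw (v & Hv & Cv & Ev). apply eq_expoE in Ev; auto.
    destruct (commute_power w v Hw Hv Cv z) as (v' & Hv' & Cv' & Ev').
    exists v'. do 2 (split; auto). apply eq_expoE; auto. rewrite Ev', Ev. auto.
Qed.

Lemma gen_expoE x : G x -> gen_expo p x <-> Z.abs (expo e x) = 1%Z.
Proof.
  intros Hx. split.
  - intros H. destruct (expo_surj e 1) as (y & Hy & E). specialize (H y Hy).
    apply div_expoE in H; auto. rewrite E in H. apply Z.divide_1_r in H. lia.
  - intros H y Hy. apply div_expoE; auto. apply Z.divide_abs_l. rewrite H. apply Z.divide_1_l.
Qed.

Lemma same_signE x y : G x -> G y -> same_sign p q x y <-> (0 < expo e x * expo e y)%Z.
Proof.
  intros Hx Hy. unfold same_sign. rewrite !trivial_atE by auto. split.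
  - intros (Nx & Ny & u & Hu & v & Hv & Fu & Fv & Eu & Ev & E).
    apply eq_expoE in Eu, Ev; auto. apply eq_expo_other_endE in E; auto.
    apply (full_support_fixed_point_free e) in Fu; auto; [|lia].
      apply (full_support_fixed_point_free e) in Fv; auto; [|lia].
    apply fixed_point_free_sign in Fu, Fv; auto. rewrite <- Eu, <- Ev. destruct e; simpl in *;
      nia.
  - intros P. split; [nia|]. split; [nia|].
    destruct (fixed_point_free_exists e (expo e x)) as (u & Hu & Fu & Eu & Eu'); [nia|].
    destruct (fixed_point_free_exists e (expo e y)) as (v & Hv & Fv & Ev & Ev'); [nia|].
    exists u. split; auto. exists v. split; auto.
    rewrite !(full_support_fixed_point_free e), !eq_expoE, eq_expo_other_endE by (auto;
      rewrite ?Eu, ?Ev; nia).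
    do 4 (split; auto). rewrite Eu', Ev'. nia.
Qed.

Lemma add_abs_expoE x y z : G x -> G y -> G z ->
  add_abs_expo p q x y z <-> (Z.abs (expo e z) = Z.abs (expo e x) + Z.abs (expo e y))%Z.
Proof.
  intros Hx Hy Hz. unfold add_abs_expo. rewrite !trivial_atE, !eq_abs_expoE by auto. split.
  - intros [[H1 H2]|[[H1 H2]|(x' & Hx' & y' & Hy' & E1 & E2 & E3 & E4)]]; [lia|lia|].
    apply eq_abs_expoE in E1, E2, E4; auto. apply same_signE in E3; auto.
    rewrite expo_mul in E4 by auto. nia.
  - intros E. destruct (Z.eq_dec (expo e x) 0); [left; lia|].
    destruct (Z.eq_dec (expo e y) 0); [right; left; lia|]. right; right.
    destruct (expo_surj e (Z.abs (expo e x))) as (x' & Hx' & Ex).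
    destruct (expo_surj e (Z.abs (expo e y))) as (y' & Hy' & Ey).
    exists x'. split; auto. exists y'. split; auto.
    rewrite !eq_abs_expoE, same_signE, expo_mul, Ex, Ey by auto. nia.
Qed.

Lemma lcm_expoE x y m : G x -> G y -> G m ->
  lcm_expo p x y m <-> forall w, ((expo e x | w) /\ (expo e y | w) <-> (expo e m | w))%Z.
Proof.
  intros Hx Hy Hm. split.
  - intros H w. destruct (expo_surj e w) as (w' & Hw' & <-). specialize (H w' Hw').
    rewrite !div_expoE in H by auto. exact H.
  - intros H w Hw. rewrite !div_expoE by auto. split; apply H.
Qed.

Lemma lcm_consecutive (x o m : Z) : Z.abs o = 1%Z ->
  (forall w, ((x | w) /\ (x + o | w) <-> (m | w)))%Z <-> (Z.abs m = Z.abs (x * (x + o)))%Z.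
Proof.
  intros Ho.
  assert (H : forall w, ((x | w) /\ (x + o | w) <-> (x * (x + o) | w))%Z).
  { intros w. split.
    (* The cofactor comes from the Bezout identity [(x + o) - x = o] together with [o * o = 1]. *)
    - intros [[a ->] [b Hb]]. exists (o * (a - b))%Z.
      assert (Ea : (a = o * (a - b) * (x + o))%Z).
      { assert (Eo : o = 1%Z \/ o = (-1)%Z) by lia. destruct Eo as [-> | ->]; lia. }
      rewrite Ea at 1. ring.
    - intros [a ->]. split; [exists (a * (x + o))%Z|exists (a * x)%Z]; ring. }
  split.
  - intros E. apply Z.divide_antisym_abs.
    + apply E, H, Z.divide_refl.
    + apply H, E, Z.divide_refl.
  - intros E w. rewrite H. rewrite <- (Z.divide_abs_l m), E. rewrite Z.divide_abs_l. tauto.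
Qed.

Lemma square_expoE o x y : G o -> G x -> G y -> Z.abs (expo e o) = 1%Z ->
  square_expo p o x y <-> expo e y = (expo e o * (expo e x * expo e x))%Z.
Proof.
  intros Ho Hx Hy E. unfold square_expo. rewrite !lcm_expoE by auto.
  rewrite !expo_mul, !expo_inv by auto. rewrite !lcm_consecutive by lia.
  generalize dependent (expo e o). generalize (expo e x) (expo e y). clear. intros x y o E.
  assert (Eo : o = 1%Z \/ o = (-1)%Z) by lia. split.
  - intros [H1 H2]. destruct Eo as [-> | ->]; nia.
  - intros ->. destruct Eo as [-> | ->]; split; lia.
Qed.

Lemma mul_abs_expoE x y z : G x -> G y -> G z ->
  mul_abs_expo p x y z <-> (Z.abs (expo e z) = Z.abs (expo e x) * Z.abs (expo e y))%Z.
Proof.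
  intros Hx Hy Hz. split.
  - intros (o & Ho & a & Ha & b & Hb & c & Hc & z' & Hz' & Go & S1 & S2 & S3 & P & E).
    apply gen_expoE in Go; auto. apply square_expoE in S1, S2, S3; auto.
    apply eq_abs_expoE in P; auto. apply eq_expoE in E; auto.
    rewrite !expo_mul in * by auto. rewrite S1, S2, S3 in E. rewrite <- P, <- Z.abs_mul.
    assert (E' : (expo e z' = expo e o * (expo e x * expo e y))%Z) by lia.
    rewrite E', Z.abs_mul, Go. lia.
  - intros E.
    destruct (expo_surj e 1) as (o & Ho & Eo).
    destruct (expo_surj e (expo e x * expo e x)) as (a & Ha & Ea).
    destruct (expo_surj e (expo e y * expo e y)) as (b & Hb & Eb).
    destruct (expo_surj e ((expo e x + expo e y) * (expo e x + expo e y))) as (c & Hc & Ec).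
    destruct (expo_surj e (expo e x * expo e y)) as (z' & Hz' & Ez).
    exists o. split; auto. exists a. split; auto. exists b. split; auto.
    exists c. split; auto. exists z'. split; auto.
    rewrite gen_expoE, !square_expoE, eq_abs_expoE, eq_expoE by (auto; rewrite Eo; reflexivity).
    rewrite !expo_mul by auto. rewrite Eo, Ea, Eb, Ec, Ez.
    split; [reflexivity|]. do 3 (split; [lia|]). split; [|ring].
    rewrite E, Z.abs_mul. reflexivity.
Qed.

End AtAnEnd.

(** * Natural numbers as elements of the group *)

Definition unit_element (p q u : R -> R) : Prop := full_support p q u /\ gen_expo p u /\
  gen_expo q u.
(* The natural number [m] is coded by the elements [u^m] and [u^-m], for any fixed-point free
   [u] with exponents [1] or [-1] at the ends. Their exponent has the same absolute value at
   both ends, so the number does not depend on which end a pair [p, q] selects. *)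
Definition numeral (x : R -> R) : Prop :=
  exists p, G p /\ exists q, G q /\ exists u, G u /\ end_pair p q /\ unit_element p q u /\
    commute x u.
(* Elements which are not numerals get the value [0]; this lets every element be a code. *)
Definition numeral_val (x : R -> R) : nat :=
  if excluded_middle_informative (numeral x) then Z.abs_nat (expo false x) else 0%nat.

Lemma unit_elementE e p q u : G p -> G q -> Ends e p q -> G u ->
  unit_element p q u <-> fixed_point_free u /\ Z.abs (expo false u) = 1%Z /\
    Z.abs (expo true u) = 1%Z.
Proof.
  intros Hp Hq He Hu. unfold unit_element.
  rewrite (gen_expoE e p q), (gen_expoE (negb e) q p) by auto using Ends_sym.
  split.
  - intros (F & E1 & E2). apply (full_support_fixed_point_free e) in F; auto; [|lia]. destruct e;
    auto.
  - intros (F & E1 & E2). rewrite (full_support_fixed_point_free e); auto; destruct e; simpl;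
    auto; lia.
Qed.

Lemma numeral_balanced x e : G x -> numeral x -> Z.abs (expo e x) = Z.of_nat (numeral_val x).
Proof.
  intros Hx D. unfold numeral_val. destruct (excluded_middle_informative (numeral x)); [|tauto].
  rewrite Zabs2Nat.id_abs.
  destruct D as (p & Hp & q & Hq & u & Hu & EPpq & Gu & C).
  destruct (end_pair_Ends p q Hp Hq EPpq) as (e' & He).
  apply (unit_elementE e') in Gu as (F & E1 & E2); auto.
  assert (X := fixed_point_free_centralizer u x Hu F E1 E2 Hx C). destruct e; auto.
Qed.

Lemma numeral_val_surj m : exists x, G x /\ numeral_val x = m.
Proof.
  destruct end_pair_exists as (p & q & Hp & Hq & HE).
  destruct (end_pair_Ends p q Hp Hq HE) as (e & He).
  destruct (fixed_point_free_exists false 1) as (u & Hu & F & E1 & E2); [lia|]. simpl in E2.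
  destruct (commute_power u u Hu Hu (commute_refl u) (Z.of_nat m)) as (v & Hv & C & Ev).
  assert (D : numeral v).
  { exists p. split; auto. exists q. split; auto. exists u. split; auto. split; auto.
    split; auto. apply (unit_elementE e); auto. rewrite E1, E2. auto. }
  exists v. split; auto. assert (X := numeral_balanced v false Hv D). rewrite Ev, E1 in X. lia.
Qed.

(** An element that is not a numeral has value 0 whatever its exponents are. Hence the stand-in [x],
    whose exponent at the end of [p] is, up to sign, the value of [a]. *)
Definition represents (p a x : R -> R) : Prop := (numeral a /\
  eq_abs_expo p a x) \/ (~ numeral a /\ trivial_at p x).
Definition numeral_add (a b c : R -> R) : Prop :=
  exists p, G p /\ exists q, G q /\ end_pair p q /\
    exists x, G x /\ exists y, G y /\ exists z, G z /\
      represents p a x /\ represents p b y /\ represents p c z /\ add_abs_expo p q x y z.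
Definition numeral_mul (a b c : R -> R) : Prop :=
  exists p, G p /\ exists q, G q /\ end_pair p q /\
    exists x, G x /\ exists y, G y /\ exists z, G z /\
      represents p a x /\ represents p b y /\ represents p c z /\ mul_abs_expo p x y z.
Definition numeral_eq (a b : R -> R) : Prop :=
  exists p, G p /\ exists q, G q /\ end_pair p q /\ exists x, G x /\ represents p a x /\
    represents p b x.

Lemma representsE e p q a x : G p -> G q -> Ends e p q -> G a -> G x ->
  represents p a x <-> Z.abs (expo e x) = Z.of_nat (numeral_val a).
Proof.
  intros Hp Hq He Ha Hx. unfold represents. rewrite (eq_abs_expoE e p q), (trivial_atE e p q) by
    auto.
  destruct (classic (numeral a)) as [D|D].
  - rewrite <- (numeral_balanced a e Ha D). split; [intros [[_ ?]|[? _]]; tauto || auto|left;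
    auto].
  - assert (E : numeral_val a = 0%nat).
    { unfold numeral_val. destruct (excluded_middle_informative (numeral a)); tauto. }
    rewrite E. simpl. split; [intros [[? _]|[_ ->]]; tauto || auto|intros; right; split; auto;
      lia].
Qed.

Lemma numeral_addE a b c : G a -> G b -> G c -> numeral_add a b c <->
  (numeral_val c = numeral_val a + numeral_val b)%nat.
Proof.
  intros Ha Hb Hc. split.
  - intros (p & Hp & q & Hq & HE & x & Hx & y & Hy & z & Hz & E1 & E2 & E3 & E4).
    destruct (end_pair_Ends p q Hp Hq HE) as (e & He).
    apply (representsE e p q) in E1, E2, E3; auto. apply (add_abs_expoE e p q) in E4; auto. lia.
  - intros E. destruct end_pair_exists as (p & q & Hp & Hq & HE).
    destruct (end_pair_Ends p q Hp Hq HE) as (e & He).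
    destruct (expo_surj e (Z.of_nat (numeral_val a))) as (x & Hx & Ex).
    destruct (expo_surj e (Z.of_nat (numeral_val b))) as (y & Hy & Ey).
    destruct (expo_surj e (Z.of_nat (numeral_val c))) as (z & Hz & Ez).
    exists p. split; auto. exists q. split; auto. split; auto.
    exists x. split; auto. exists y. split; auto. exists z. split; auto.
    rewrite !(representsE e p q), (add_abs_expoE e p q) by auto. lia.
Qed.

Lemma numeral_mulE a b c : G a -> G b -> G c -> numeral_mul a b c <->
  (numeral_val c = numeral_val a * numeral_val b)%nat.
Proof.
  intros Ha Hb Hc. split.
  - intros (p & Hp & q & Hq & HE & x & Hx & y & Hy & z & Hz & E1 & E2 & E3 & E4).
    destruct (end_pair_Ends p q Hp Hq HE) as (e & He).
    apply (representsE e p q) in E1, E2, E3; auto. apply (mul_abs_expoE e p q) in E4; auto. nia.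
  - intros E. destruct end_pair_exists as (p & q & Hp & Hq & HE).
    destruct (end_pair_Ends p q Hp Hq HE) as (e & He).
    destruct (expo_surj e (Z.of_nat (numeral_val a))) as (x & Hx & Ex).
    destruct (expo_surj e (Z.of_nat (numeral_val b))) as (y & Hy & Ey).
    destruct (expo_surj e (Z.of_nat (numeral_val c))) as (z & Hz & Ez).
    exists p. split; auto. exists q. split; auto. split; auto.
    exists x. split; auto. exists y. split; auto. exists z. split; auto.
    rewrite !(representsE e p q), (mul_abs_expoE e p q) by auto. rewrite Ex, Ey, Ez. nia.
Qed.

Lemma numeral_eqE a b : G a -> G b -> numeral_eq a b <-> numeral_val a = numeral_val b.
Proof.
  intros Ha Hb. split.
  - intros (p & Hp & q & Hq & HE & x & Hx & E1 & E2).
    destruct (end_pair_Ends p q Hp Hq HE) as (e & He).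
    apply (representsE e p q) in E1, E2; auto. lia.
  - intros E. destruct end_pair_exists as (p & q & Hp & Hq & HE).
    destruct (end_pair_Ends p q Hp Hq HE) as (e & He).
    destruct (expo_surj e (Z.of_nat (numeral_val a))) as (x & Hx & Ex).
    exists p. split; auto. exists q. split; auto. split; auto.
    exists x. split; auto. rewrite !(representsE e p q) by auto. lia.
Qed.

(** * Definability *)

(** Terms and predicates stay Rocq functions of the environment, with the existence of a syntactic
    counterpart as a property. Dependence on the first [n] variables is recorded so that variable
    [n] is free to be bound. *)
Definition term_fun (n : nat) (s : (nat -> R -> R) -> R -> R) : Prop :=
  (exists tau, forall e, s e = geval r e tau) /\
  forall e e', agree n e e' -> s e = s e'.

Definition definable (n : nat) (X : (nat -> R -> R) -> Prop) : Prop :=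
  (exists phi, forall e, env_in G e -> (X e <-> sat G (geval r) e phi)) /\
  forall e e', env_in G e -> env_in G e' -> agree n e e' -> (X e <-> X e').

Lemma term_fun_le m n s : term_fun m s -> (m <= n)%nat -> term_fun n s.
Proof. intros [H1 H2] L. split; auto. intros e e' H. apply H2. intros i Hi. apply H. lia. Qed.

Lemma term_fun_var n i : (i < n)%nat -> term_fun n (fun e => e i).
Proof. intros H. split; [exists (gvar i); reflexivity|]. intros e e' E. apply E; auto. Qed.

Lemma term_fun_mul n s t : term_fun n s -> term_fun n t -> term_fun n (fun e => Fmul (s e) (t e)).
Proof.
  intros [[tau Es] Ls] [[tau' Et] Lt]. split.
  - exists (gmul tau tau'). intros e. simpl. rewrite Es, Et. auto.
  - intros e e' H. rewrite (Ls e e'), (Lt e e'); auto.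
Qed.

Lemma term_fun_inv n s : term_fun n s -> term_fun n (fun e => inv (s e)).
Proof.
  intros [[tau Es] Ls]. split.
  - exists (ginv tau). intros e. simpl. rewrite Es. auto.
  - intros e e' H. rewrite (Ls e e'); auto.
Qed.

Lemma term_fun_commutator n s t : term_fun n s -> term_fun n t ->
  term_fun n (fun e => commutator (s e) (t e)).
Proof. intros. unfold commutator. auto using term_fun_mul, term_fun_inv. Qed.

Lemma term_fun_conjugate n s t : term_fun n s -> term_fun n t ->
  term_fun n (fun e => conjugate (s e) (t e)).
Proof. intros. unfold conjugate. auto using term_fun_mul, term_fun_inv. Qed.

Lemma term_fun_G n s e : term_fun n s -> env_in G e -> G (s e).
Proof.
  intros [[tau Es] _] He. rewrite Es. clear s Es.
  induction tau; simpl; auto.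
Qed.

Lemma upd_env_in e n m : env_in G e -> G m -> env_in G (upd e n m).
Proof. intros He Hm i. unfold upd. destruct (Nat.eqb i n); auto. Qed.

Lemma upd_same e n (m : R -> R) : upd e n m n = m.
Proof. unfold upd. rewrite Nat.eqb_refl. auto. Qed.

Lemma agree_upd e n (m : R -> R) : agree n e (upd e n m).
Proof.
  intros i Hi. unfold upd. destruct (Nat.eqb_spec i n); auto. lia.
Qed.

Lemma definable_ext n X Y : definable n Y -> (forall e, env_in G e -> (X e <-> Y e)) ->
  definable n X.
Proof.
  intros [[phi H1] H2] E. split.
  - exists phi. intros e He. rewrite E; auto.
  - intros e e' He He' H. rewrite !E; auto.
Qed.

Lemma definable_eq n s t : term_fun n s -> term_fun n t -> definable n (fun e => s e = t e).
Proof.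
  intros [[tau Es] Ls] [[tau' Et] Lt]. split.
  - exists (fEq tau tau'). intros e _. simpl. rewrite Es, Et. tauto.
  - intros e e' _ _ H. rewrite (Ls e e'), (Lt e e'); auto. tauto.
Qed.

Lemma definable_not n X : definable n X -> definable n (fun e => ~ X e).
Proof.
  intros [[phi H1] H2]. split.
  - exists (fNot phi). intros e He. simpl. rewrite H1; auto. tauto.
  - intros e e' He He' H. rewrite (H2 e e'); auto. tauto.
Qed.

Lemma definable_and n X Y : definable n X -> definable n Y -> definable n (fun e => X e /\ Y e).
Proof.
  intros [[phi H1] H2] [[psi H3] H4]. split.
  - exists (fAnd phi psi). intros e He. simpl. rewrite H1, H3; auto. tauto.
  - intros e e' He He' H. rewrite (H2 e e'), (H4 e e'); auto. tauto.
Qed.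

Lemma definable_or n X Y : definable n X -> definable n Y -> definable n (fun e => X e \/ Y e).
Proof.
  intros [[phi H1] H2] [[psi H3] H4]. split.
  - exists (fOr phi psi). intros e He. simpl. rewrite H1, H3; auto. tauto.
  - intros e e' He He' H. rewrite (H2 e e'), (H4 e e'); auto. tauto.
Qed.

Lemma definable_imp n X Y : definable n X -> definable n Y -> definable n (fun e => X e -> Y e).
Proof.
  intros [[phi H1] H2] [[psi H3] H4]. split.
  - exists (fImp phi psi). intros e He. simpl. rewrite H1, H3; auto. tauto.
  - intros e e' He He' H. rewrite (H2 e e'), (H4 e e'); auto. tauto.
Qed.

(** The bound variable is [n], fresh since [Y] depends only on the coordinates below [n]; in the
    premise the quantified element is read as [e n]. *)
Lemma definable_all n (Y : (nat -> R -> R) -> (R -> R) -> Prop) :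
  (forall e e' m, agree n e e' -> (Y e m <-> Y e' m)) ->
  definable (S n) (fun e => Y e (e n)) -> definable n (fun e => forall m, G m -> Y e m).
Proof.
  intros L [[phi H1] _]. split.
  - exists (fAll n phi). intros e He. simpl.
    split; intros H m Hm; specialize (H m Hm).
    + apply H1; [apply upd_env_in; auto|]. rewrite upd_same.
      apply (L e); auto. apply agree_upd.
    + apply H1 in H; [|apply upd_env_in; auto]. rewrite upd_same in H.
      apply (L e) in H; auto. apply agree_upd.
  - intros e e' _ _ H. split; intros K m Hm; specialize (K m Hm).
    + apply (L e e'); auto.
    + apply (L e e'); auto.
Qed.

Lemma definable_ex n (Y : (nat -> R -> R) -> (R -> R) -> Prop) :
  (forall e e' m, agree n e e' -> (Y e m <-> Y e' m)) ->
  definable (S n) (fun e => Y e (e n)) -> definable n (fun e => exists m, G m /\ Y e m).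
Proof.
  intros L [[phi H1] _]. split.
  - exists (fEx n phi). intros e He. simpl.
    split; intros (m & Hm & H); exists m; split; auto.
    + apply H1; [apply upd_env_in; auto|]. rewrite upd_same.
      apply (L e); auto. apply agree_upd.
    + apply H1 in H; [|apply upd_env_in; auto]. rewrite upd_same in H.
      apply (L e) in H; auto. apply agree_upd.
  - intros e e' _ _ H. split; intros (m & Hm & K); exists m; split; auto.
    + apply (L e e'); auto.
    + apply (L e e'); auto.
Qed.

Ltac locality :=
  let e := fresh in let e' := fresh in let m := fresh in let H := fresh in
  intros e e' m H;
  repeat match goal with
  | Hs : term_fun ?k ?s |- context [?s e] =>
      rewrite (proj2 Hs e e') by (intros ? ?; apply H; lia)
  end;
  repeat match goal with
  | |- context [e ?i] => rewrite (H i) by lia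
  end;
  reflexivity.

Ltac prove_term_fun :=
  cbv beta;
  lazymatch goal with
  | |- term_fun _ (fun e => Fmul (@?s e) (@?t e)) => apply (term_fun_mul _ s t); prove_term_fun
  | |- term_fun _ (fun e => Finv _ (@?s e)) => apply (term_fun_inv _ s); prove_term_fun
  | |- term_fun _ (fun e => commutator (@?s e) (@?t e)) => apply (term_fun_commutator _ s t);
    prove_term_fun
  | |- term_fun _ (fun e => conjugate (@?s e) (@?t e)) => apply (term_fun_conjugate _ s t);
    prove_term_fun
  | |- term_fun _ (fun e => e _) => apply term_fun_var; lia
  | |- _ => match goal with H : term_fun ?k ?s |- term_fun _ ?t => apply (term_fun_le k _ s H);
    lia end
  end.

(** [tac] supplies the lemmas for notions already treated; connectives and quantifiers are peeled
    off by the shape of the goal. *)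
Ltac prove_definable tac :=
  cbv beta;
  lazymatch goal with
  | |- term_fun _ _ => prove_term_fun
  | _ => first
    [ tac; prove_definable tac
    | apply definable_all; [locality|prove_definable tac]
    | apply definable_ex; [locality|prove_definable tac]
    | apply definable_and; prove_definable tac
    | apply definable_or; prove_definable tac
    | apply definable_imp; prove_definable tac
    | apply definable_not; prove_definable tac
    | apply definable_eq; prove_definable tac ]
  end.

Lemma definable_commute n s t : term_fun n s -> term_fun n t ->
  definable n (fun e => commute (s e) (t e)).
Proof. intros. unfold commute. prove_definable fail. Qed.

Lemma definable_commutes_with_commutators n s t : term_fun n s -> term_fun n t ->
  definable n (fun e => commutes_with_commutators (s e) (t e)).
Proof. intros. unfold commutes_with_commutators. prove_definable ltac:(apply definable_commute).
  Qed.

Lemma definable_disjoint n s t : term_fun n s -> term_fun n t ->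
  definable n (fun e => disjoint (s e) (t e)).
Proof. intros. unfold disjoint.
  prove_definable ltac:(first [apply definable_commute | apply definable_commutes_with_commutators]). Qed.

Lemma definable_trivial_at n s t : term_fun n s -> term_fun n t ->
  definable n (fun e => trivial_at (s e) (t e)).
Proof. intros. unfold trivial_at. prove_definable ltac:(apply definable_disjoint). Qed.

Lemma definable_end_pair n s t : term_fun n s -> term_fun n t ->
  definable n (fun e => end_pair (s e) (t e)).
Proof. intros. unfold end_pair.
  prove_definable ltac:(first [apply definable_disjoint | apply definable_trivial_at]). Qed.

Lemma definable_full_support n p q s : term_fun n p -> term_fun n q -> term_fun n s ->
  definable n (fun e => full_support (p e) (q e) (s e)).
Proof.
  intros. unfold full_support.
    prove_definable ltac:(first [apply definable_commute | apply definable_disjoint | apply definable_trivial_at]).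
Qed.

Lemma definable_eq_expo n p s t : term_fun n p -> term_fun n s -> term_fun n t ->
  definable n (fun e => eq_expo (p e) (s e) (t e)).
Proof. intros. unfold eq_expo. prove_definable ltac:(apply definable_trivial_at). Qed.

Lemma definable_div_expo n p s t : term_fun n p -> term_fun n s -> term_fun n t ->
  definable n (fun e => div_expo (p e) (s e) (t e)).
Proof. intros. unfold div_expo.
  prove_definable ltac:(first [apply definable_commute | apply definable_eq_expo]). Qed.

Lemma definable_gen_expo n p s : term_fun n p -> term_fun n s ->
  definable n (fun e => gen_expo (p e) (s e)).
Proof. intros. unfold gen_expo. prove_definable ltac:(apply definable_div_expo). Qed.

Lemma definable_same_sign n p q s t : term_fun n p -> term_fun n q -> term_fun n s ->
  term_fun n t ->
  definable n (fun e => same_sign (p e) (q e) (s e) (t e)).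
Proof.
  intros. unfold same_sign.
    prove_definable ltac:(first [apply definable_trivial_at | apply definable_full_support | apply definable_eq_expo]).
Qed.

Lemma definable_eq_abs_expo n p s t : term_fun n p -> term_fun n s -> term_fun n t ->
  definable n (fun e => eq_abs_expo (p e) (s e) (t e)).
Proof. intros. unfold eq_abs_expo.
  prove_definable ltac:(first [apply definable_trivial_at | apply definable_eq_expo]). Qed.

Lemma definable_add_abs_expo n p q s t u : term_fun n p -> term_fun n q -> term_fun n s ->
  term_fun n t -> term_fun n u ->
  definable n (fun e => add_abs_expo (p e) (q e) (s e) (t e) (u e)).
Proof.
  intros. unfold add_abs_expo.
    prove_definable ltac:(first [apply definable_trivial_at | apply definable_eq_abs_expo | apply definable_same_sign]).
Qed.

Lemma definable_lcm_expo n p s t u : term_fun n p -> term_fun n s -> term_fun n t ->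
  term_fun n u ->
  definable n (fun e => lcm_expo (p e) (s e) (t e) (u e)).
Proof. intros. unfold lcm_expo. prove_definable ltac:(apply definable_div_expo). Qed.

Lemma definable_square_expo n p s t u : term_fun n p -> term_fun n s -> term_fun n t ->
  term_fun n u ->
  definable n (fun e => square_expo (p e) (s e) (t e) (u e)).
Proof. intros. unfold square_expo. prove_definable ltac:(apply definable_lcm_expo). Qed.

Lemma definable_mul_abs_expo n p s t u : term_fun n p -> term_fun n s -> term_fun n t ->
  term_fun n u ->
  definable n (fun e => mul_abs_expo (p e) (s e) (t e) (u e)).
Proof.
  intros. unfold mul_abs_expo.
  prove_definable ltac:(first [apply definable_gen_expo | apply definable_square_expo | apply definable_eq_abs_expo | apply definable_eq_expo]).
Qed.

Lemma definable_numeral n s : term_fun n s -> definable n (fun e => numeral (s e)).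
Proof.
  intros. unfold numeral, unit_element.
  prove_definable ltac:(first [apply definable_end_pair | apply definable_full_support | apply definable_gen_expo | apply definable_commute]).
Qed.

Lemma definable_represents n p s t : term_fun n p -> term_fun n s -> term_fun n t ->
  definable n (fun e => represents (p e) (s e) (t e)).
Proof.
  intros. unfold represents.
    prove_definable ltac:(first [apply definable_numeral | apply definable_eq_abs_expo | apply definable_trivial_at]).
Qed.

Lemma definable_numeral_val_add n s t u : term_fun n s -> term_fun n t -> term_fun n u ->
  definable n (fun e => (numeral_val (u e) = numeral_val (s e) + numeral_val (t e))%nat).
Proof.
  intros. apply definable_ext with (fun e => numeral_add (s e) (t e) (u e)).
  - unfold numeral_add. prove_definable ltac:(first [apply definable_end_pair | apply definable_represents | apply definable_add_abs_expo]).
  - intros e He. rewrite numeral_addE by (eapply term_fun_G; eauto). tauto.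
Qed.

Lemma definable_numeral_val_mul n s t u : term_fun n s -> term_fun n t -> term_fun n u ->
  definable n (fun e => (numeral_val (u e) = numeral_val (s e) * numeral_val (t e))%nat).
Proof.
  intros. apply definable_ext with (fun e => numeral_mul (s e) (t e) (u e)).
  - unfold numeral_mul. prove_definable ltac:(first [apply definable_end_pair | apply definable_represents | apply definable_mul_abs_expo]).
  - intros e He. rewrite numeral_mulE by (eapply term_fun_G; eauto). tauto.
Qed.

Lemma definable_numeral_val_eq n s t : term_fun n s -> term_fun n t ->
  definable n (fun e => numeral_val (s e) = numeral_val (t e)).
Proof.
  intros. apply definable_ext with (fun e => numeral_eq (s e) (t e)).
  - unfold numeral_eq. prove_definable ltac:(first [apply definable_end_pair | apply definable_represents]).
  - intros e He. rewrite numeral_eqE by (eapply term_fun_G; eauto). tauto.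
Qed.

(** * Translation of arithmetic formulas *)

Definition numeral_vals (e : nat -> R -> R) : nat -> nat := fun j => numeral_val (e j).

(** Group terms do not compute sums or products of values, so a compound arithmetic term is
    unnested: two quantified elements carry the values of its subterms. *)
Lemma definable_numeral_val_op (op : nat -> nat -> nat) f1 f2 N1 N2 :
  (forall n s t u, term_fun n s -> term_fun n t -> term_fun n u ->
    definable n (fun e => numeral_val (u e) = op (numeral_val (s e)) (numeral_val (t e)))) ->
  (forall e e', agree N1 e e' -> f1 e = f1 e') ->
  (forall n s, (N1 <= n)%nat -> term_fun n s ->
    definable n (fun e => numeral_val (s e) = f1 e)) ->
  (forall e e', agree N2 e e' -> f2 e = f2 e') ->
  (forall n s, (N2 <= n)%nat -> term_fun n s ->
    definable n (fun e => numeral_val (s e) = f2 e)) ->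
  forall n s, (max N1 N2 <= n)%nat -> term_fun n s ->
    definable n (fun e => numeral_val (s e) = op (f1 e) (f2 e)).
Proof.
  intros Hop L1 D1 L2 D2 n s Hn Hs.
  apply definable_ext with (fun e => exists x, G x /\ exists y, G y /\
    numeral_val x = f1 e /\ numeral_val y = f2 e /\
      numeral_val (s e) = op (numeral_val x) (numeral_val y)).
  - apply definable_ex; [|apply definable_ex]; cbv beta.
    + intros e e' m H. rewrite (L1 e e'), (L2 e e'), (proj2 Hs e e');
        try reflexivity; intros i Hi; apply H; lia.
    + intros e e' m H. rewrite (L1 e e'), (L2 e e'), (proj2 Hs e e'), (H n);
        try reflexivity; try (intros i Hi; apply H); lia.
    + apply definable_and; [apply D1; [lia|prove_term_fun]|]. apply definable_and; [apply D2;
      [lia|prove_term_fun]|].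
      apply Hop; prove_term_fun.
  - intros e He. split.
    + intros E. destruct (numeral_val_surj (f1 e)) as (x & Hx & Ex).
      destruct (numeral_val_surj (f2 e)) as (y & Hy & Ey).
      exists x. split; auto. exists y. rewrite Ex, Ey. auto.
    + intros (x & _ & y & _ & Ex & Ey & E). congruence.
Qed.

(** [N] exceeds every variable of [t], so elements quantified at positions from [N] on capture none
    of them. *)
Lemma definable_aterm t : exists N,
  (forall e e', agree N e e' -> aeval (numeral_vals e) t = aeval (numeral_vals e') t) /\
  forall n s, (N <= n)%nat -> term_fun n s ->
    definable n (fun e => numeral_val (s e) = aeval (numeral_vals e) t).
Proof.
  induction t as [i|t1 (N1 & L1 & D1) t2 (N2 & L2 & D2)|t1 (N1 & L1 & D1) t2 (N2 & L2 & D2)].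
  - exists (S i). split.
    + intros e e' H. simpl. unfold numeral_vals. rewrite (H i) by lia. auto.
    + intros n s Hn Hs. unfold numeral_vals. simpl. apply definable_numeral_val_eq;
      prove_term_fun.
  - exists (max N1 N2). split.
    + intros e e' H. simpl. rewrite (L1 e e'), (L2 e e'); auto; intros i Hi; apply H; lia.
    + exact (definable_numeral_val_op Nat.add _ _ N1 N2 definable_numeral_val_add L1 D1 L2 D2).
  - exists (max N1 N2). split.
    + intros e e' H. simpl. rewrite (L1 e e'), (L2 e e'); auto; intros i Hi; apply H; lia.
    + exact (definable_numeral_val_op Nat.mul _ _ N1 N2 definable_numeral_val_mul L1 D1 L2 D2).
Qed.

Lemma numeral_vals_upd e n x : numeral_vals (upd e n x) = upd (numeral_vals e) n (numeral_val x).
Proof. extensionality j. unfold numeral_vals, upd. destruct (Nat.eqb j n); auto. Qed.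

(** Variables keep their indices. Every group element is a code and every number has one, so
    quantifiers over numbers become plain quantifiers over the group; an equation asks for one
    element carrying the value of both sides. *)
Lemma arithmetic_formula_definable (phi : formula aterm) : exists psi, forall e, env_in G e ->
  (sat (fun _ => True) aeval (numeral_vals e) phi <-> sat G (geval r) e psi).
Proof.
  induction phi as [s t|a (a' & IHa)|a (a' & IHa) b (b' & IHb)|a (a' & IHa) b (b' & IHb)
    |a (a' & IHa) b (b' & IHb)|n a (a' & IHa)|n a (a' & IHa)].
  - destruct (definable_aterm s) as (N1 & L1 & D1).
    destruct (definable_aterm t) as (N2 & L2 & D2).
    set (n := max N1 N2).
    assert (D : definable n (fun e => exists x, G x /\
      (numeral_val x = aeval (numeral_vals e) s /\ numeral_val x = aeval (numeral_vals e) t))).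
    { apply definable_ex; cbv beta.
      - intros e e' m H. rewrite (L1 e e'), (L2 e e');
          try reflexivity; intros i Hi; apply H; lia.
      - apply definable_and; [apply D1|apply D2]; try lia; prove_term_fun. }
    destruct D as [[psi D] _]. exists psi. intros e He. rewrite <- D by auto. simpl. split.
    + intros E. destruct (numeral_val_surj (aeval (numeral_vals e) s)) as (x & Hx & Ex).
      exists x. split; auto. split; congruence.
    + intros (x & _ & E1 & E2). congruence.
  - exists (fNot a'). intros e He. simpl. rewrite IHa; tauto.
  - exists (fAnd a' b'). intros e He. simpl. rewrite IHa, IHb; tauto.
  - exists (fOr a' b'). intros e He. simpl. rewrite IHa, IHb; tauto.
  - exists (fImp a' b'). intros e He. simpl. rewrite IHa, IHb; tauto.
  - exists (fAll n a'). intros e He. simpl. split.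
    + intros H x Hx. apply IHa; [apply upd_env_in; auto|]. rewrite numeral_vals_upd. auto.
    + intros H m _. destruct (numeral_val_surj m) as (x & Hx & <-).
      rewrite <- numeral_vals_upd. apply IHa; [apply upd_env_in; auto|auto].
  - exists (fEx n a'). intros e He. simpl. split.
    + intros (m & _ & H). destruct (numeral_val_surj m) as (x & Hx & <-). exists x. split; auto.
      apply IHa; [apply upd_env_in; auto|]. rewrite numeral_vals_upd. auto.
    + intros (x & Hx & H). exists (numeral_val x). split; auto.
      rewrite <- numeral_vals_upd. apply IHa; [apply upd_env_in; auto|auto].
Qed.

Lemma interpretation : interprets_arith G (geval r).
Proof.
  exists 1%nat, (fun _ => True), (fun a => numeral_val (a 0%nat)).
  split; [intros a b _ _ _; tauto|].
  split; [intros a b _ _ H _; rewrite (H 0%nat); auto|].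
  split.
  - intros m. destruct (numeral_val_surj m) as (x & Hx & E). exists (fun _ => x).
    split; [intros i; auto|auto].
  - intros k X [L (phi & HX)].
    assert (B : forall b, (fun j => numeral_val (block 1 j b 0%nat)) = numeral_vals b).
    { intros b. extensionality j. unfold numeral_vals, block. do 2 f_equal. lia. }
    split.
    + intros a b Ha Hb H. rewrite !B.
      assert (E : X (numeral_vals a) <-> X (numeral_vals b)); [|tauto].
      apply L; try (intros i; exact I). intros i Hi. unfold numeral_vals. rewrite (H i); auto.
        lia.
    + destruct (arithmetic_formula_definable phi) as (psi & Hpsi). exists psi. intros e He.
      rewrite B, <- Hpsi, <- HX by (auto; intros i; exact I). tauto.
Qed.

End Interpretation.

(** * Choice of a generator below 1, and the conclusion *)

Lemma cyclic_contracting_generator (r : R) (Lam A : R -> Prop) :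
  admissible r Lam A -> cyclic_subgroup Lam -> (exists l, Lam l /\ l <> 1) ->
  exists g, 0 < g < 1 /\ forall l, Lam l <-> exists z : Z, l = powerRZ g z.
Proof.
  intros (_ & (Hpos & _) & _) (g & Hg) (l & Hl & Hl1).
  assert (g0 : 0 < g) by (apply Hpos, Hg; exists 1%Z; rewrite powerRZ_1; auto).
  destruct (Rtotal_order g 1) as [L|[->|L]].
  - exists g. split; [lra|auto].
  - exfalso. apply Hl1. apply Hg in Hl as (z & ->). apply powerRZ_R1.
  (* A generator above 1 is replaced by its inverse, which negates the exponents. *)
  - exists (/ g). split.
    + split; [apply Rinv_0_lt_compat; auto|]. rewrite <- Rinv_1. apply Rinv_lt_contravar; lra.
    + intros m. rewrite Hg. split; intros (z & ->); exists (- z)%Z.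
      * rewrite powerRZ_inv', powerRZ_neg', Rinv_inv. auto.
      * rewrite powerRZ_inv', powerRZ_neg'. auto.
Qed.

Theorem theoremB (r : R) (Lam A : R -> Prop) :
  admissible r Lam A ->
  cyclic_subgroup Lam ->
  (exists l, Lam l /\ l <> 1) ->
  interprets_arith (InF r Lam A) (geval r).
Proof.
  intros adm Hc Hn.
  destruct (cyclic_contracting_generator r Lam A adm Hc Hn) as (g & Hg & HL).
  exact (interpretation r Lam A adm g Hg HL).
Qed.
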